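(* Fix $c>1$. There exist constants $C_b>0$ and $C_B>1$ such that with high probability the largest component $H_{n,c/n}$ of $G_{n,c/n}$ has the property that every Lipschitz function $f:V(H_{n,c/n})\to\mathbb{R}$ satisfies $$|\{v\in V(H_{n,c/n}): |f(v)-m|> x\}| < C_b\, C_B^{-\sqrt{x}}\, n \qquad\text{for all } x\ge 0,$$ where $m$ is a median of $f$.
   Context: $G_{n,p}$ is the Erdős–Rényi random graph on $n$ vertices with edge probability $p$; $H_{n,p}$ denotes its largest component. ''With high probability'' means with probability $1-o(1)$ as $n\to\infty$. A Lipschitz function on a graph is a real function on its vertices with $|f(v)-f(w)|\le1$ for adjacent $v,w$. A function on the vertex set is regarded as a random variable evaluated at a uniformly random vertex of $H_{n,c/n}$; a median $m$ of $f$ is a real number such that at least half of the vertices of $H_{n,c/n}$ have $f(v)\ge m$ and at least half have $f(v)\le m$. *)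

(* Defs.v *)
From HB Require Import structures.
From mathcomp Require Import all_boot all_order all_algebra.
From mathcomp Require Import boolp classical_sets reals exp.
Set Implicit Arguments. Unset Strict Implicit. Unset Printing Implicit Defensive.
Import Order.TTheory GRing.Theory Num.Theory.
Local Open Scope ring_scope.

(* A (candidate) graph on vertex set 'I_n: a set of 2-element vertex sets. *)
Definition graph (n : nat) := {set {set 'I_n}}.

Definition simple_graph (n : nat) (E : graph n) : bool :=
  [forall e in E, #|e| == 2%N].

Definition adj (n : nat) (E : graph n) : rel 'I_n :=
  fun u v => (u != v) && ([set u; v] \in E).

Definition component (n : nat) (E : graph n) (v : 'I_n) : {set 'I_n} :=
  [set w | connect (adj E) v w].

Definition largest_component (n : nat) (E : graph n) (H : {set 'I_n}) : Prop :=
  (exists v, H = component E v) /\ (forall v, (#|component E v| <= #|H|)%N).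

Definition gnp_weight (R : realType) (n : nat) (p : R) (E : graph n) : R :=
  if simple_graph E then p ^+ #|E| * (1 - p) ^+ ('C(n, 2) - #|E|) else 0.

Definition gnp_prob (R : realType) (n : nat) (p : R) (P : graph n -> Prop) : R :=
  \sum_(E : graph n | `[< P E >]) gnp_weight p E.

Definition lipschitz_on (R : realType) (n : nat) (E : graph n)
  (H : {set 'I_n}) (f : 'I_n -> R) : Prop :=
  forall v w, v \in H -> w \in H -> adj E v w -> `|f v - f w| <= 1.

Definition is_median (R : realType) (n : nat) (H : {set 'I_n})
  (f : 'I_n -> R) (m : R) : Prop :=
  let up := [set v in H | m <= f v] in
  let lo := [set v in H | f v <= m] in
  (#|H| <= 2 * #|up|)%N /\ (#|H| <= 2 * #|lo|)%N.

(* Main.v *)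
Require Import Defs.
From HB Require Import structures.
From mathcomp Require Import all_boot all_order all_algebra.
From mathcomp Require Import boolp reals sequences exp.
From mathcomp Require Import zify ring lra.
Set Implicit Arguments. Unset Strict Implicit. Unset Printing Implicit Defensive.
Import Order.TTheory GRing.Theory Num.Theory.
Local Open Scope ring_scope.

(** The tail is in fact exponential in [x]; three facts hold with high probability.

    Expansion: a set [S] of size at most [delta n] spanned by a forest with few trees has an inner
    vertex boundary larger than [eps |S|]. This is a first moment bound over the set, the parent
    function of the forest and the boundary; a root is paid for by a factor [lam |S| / n], a boundary
    vertex by a factor [exp (- Z)]. The resulting sum is geometric because [c * exp (1 - c) < 1].

    Robustness: two linear-size sets, each spanned by a forest with few trees, cannot be separated by
    fewer than [e2 n] edges. Write the graph as [E1 :|: E2] with [E2] a sparse independent sprinkling.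
    By expansion almost all vertices of such a set lie in components of [E1] of linear size. There are
    boundedly many of those, so a sparse cut of [E1] is determined by its few edges and finitely many
    bits, and a union bound over these cuts beats the probability that [E2] respects one of them.

    Edges: there are at most [2 c n] of them.

    Let [A] be the set where [f > m + x] and [B] the set where [f <= m]; the median property gives
    [|A| <= |B|]. The balls of radius [i] around [A] are spanned by forests whose trees have more than
    [i] vertices, so after [O(log (n / |A|))] steps expansion makes them grow geometrically to linear
    size, and likewise for [B]. Edge boundaries of successive balls are disjoint, so a bounded number of
    further steps contradicts robustness unless the balls have met. Hence [x = O(log (n / |A|))]. *)

(** * The random graph as a product measure *)

(** Subsets that are not 2-element sets get the point mass at absence, so the law is a product over
    the whole type [{set 'I_n}], with simplicity built in. *)
Definition edge_weight (R : realType) (n : nat) (p : R) (e : {set 'I_n}) (b : bool) : R :=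
  if #|e| == 2%N then (if b then p else 1 - p) else (~~ b)%:R.

Lemma gnp_weight_prod (R : realType) (n : nat) (p : R) (E : graph n) :
  gnp_weight p E = \prod_e edge_weight p e (e \in E).
Proof.
rewrite /gnp_weight; case: ifPn => [/forall_inP simE | nsimE]; last first.
  case/forall_inPn: nsimE => e eE ne2.
  by rewrite (bigD1 e) //= /edge_weight (negbTE ne2) eE mul0r.
have sub2 : E \subset [set e : {set 'I_n} | #|e| == 2%N].
  by apply/subsetP => e eE; rewrite inE; apply: simE.
rewrite (bigID (fun e => e \in E)) /=; congr (_ * _).
  rewrite (eq_bigr (fun=> p)) ?prodr_const // => e eE.
  by rewrite /edge_weight eE (simE _ eE).
rewrite (bigID (fun e : {set 'I_n} => #|e| == 2%N)) /= [X in _ * X]big1 ?mulr1; last first.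
  by move=> e /andP[/negbTE eE /negbTE ne2]; rewrite /edge_weight eE ne2.
rewrite (eq_bigr (fun=> 1 - p)); last first.
  by move=> e /andP[/negbTE eE e2]; rewrite /edge_weight eE e2.
rewrite prodr_const; congr (_ ^+ _).
have -> : 'C(n, 2) = #|[set e : {set 'I_n} | #|e| == 2%N]| by rewrite card_draws card_ord.
rewrite -cardsDS //; apply: eq_card => e.
by rewrite !inE.
Qed.

Lemma sum_set_prod (R : realType) (T : finType) (h : T -> bool -> R) :
  \sum_(E : {set T}) \prod_e h e (e \in E) = \prod_e (h e true + h e false).
Proof.
rewrite bigA_distr; apply: eq_bigr => E _; apply: eq_bigr => e _.
by case: (e \in E).
Qed.

Definition gnp_exp (R : realType) (n : nat) (p : R) (g : graph n -> R) : R :=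
  \sum_(E : graph n) gnp_weight p E * g E.

Lemma gnp_prob_exp (R : realType) (n : nat) (p : R) (P : graph n -> Prop) :
  gnp_prob p P = gnp_exp p (fun E => `[< P E >]%:R).
Proof.
rewrite /gnp_prob /gnp_exp big_mkcond; apply: eq_bigr => E _.
by case: `[< P E >]; rewrite ?mulr1 ?mulr0.
Qed.

Lemma gnp_exp_prod (R : realType) (n : nat) (p : R) (h : {set 'I_n} -> bool -> R) :
  gnp_exp p (fun E => \prod_e h e (e \in E)) =
  \prod_e (edge_weight p e true * h e true + edge_weight p e false * h e false).
Proof.
rewrite -(sum_set_prod (fun e b => edge_weight p e b * h e b)).
by apply: eq_bigr => E _; rewrite gnp_weight_prod big_split.
Qed.

Lemma edge_weightT (R : realType) (n : nat) (p : R) (e : {set 'I_n}) :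
  edge_weight p e true + edge_weight p e false = 1.
Proof. by rewrite /edge_weight; case: ifP => _ /=; rewrite ?add0r // addrC subrK. Qed.

Lemma eq_gnp_exp (R : realType) (n : nat) (p : R) (g h : graph n -> R) :
  g =1 h -> gnp_exp p g = gnp_exp p h.
Proof. by move=> gh; apply: eq_bigr => E _; rewrite gh. Qed.

Lemma gnp_exp1 (R : realType) (n : nat) (p : R) : gnp_exp p (fun _ : graph n => 1) = 1.
Proof.
rewrite (@eq_gnp_exp _ _ _ _ (fun E => \prod_(e : {set 'I_n}) 1)); last first.
  by move=> E; rewrite big1.
rewrite (gnp_exp_prod p (fun _ _ => 1)) big1 // => e _.
by rewrite !mulr1 edge_weightT.
Qed.

Lemma gnp_weight_ge0 (R : realType) (n : nat) (p : R) (E : graph n) :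
  0 <= p <= 1 -> 0 <= gnp_weight p E.
Proof.
move=> /andP[p0 p1]; rewrite /gnp_weight; case: ifP => // _.
by rewrite mulr_ge0 ?exprn_ge0 // subr_ge0.
Qed.

Lemma gnp_exp_le (R : realType) (n : nat) (p : R) (g h : graph n -> R) :
  0 <= p <= 1 -> (forall E, g E <= h E) -> gnp_exp p g <= gnp_exp p h.
Proof. by move=> p01 gh; apply: ler_sum => E _; rewrite ler_wpM2l ?gnp_weight_ge0. Qed.

Lemma gnp_exp_sum (R : realType) (n : nat) (p : R) (I : finType) (P : pred I)
    (g : I -> graph n -> R) :
  gnp_exp p (fun E => \sum_(i | P i) g i E) = \sum_(i | P i) gnp_exp p (g i).
Proof.
by rewrite /gnp_exp exchange_big; apply: eq_bigr => E _; rewrite mulr_sumr.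
Qed.

Lemma gnp_expZ (R : realType) (n : nat) (p a : R) (g : graph n -> R) :
  gnp_exp p (fun E => a * g E) = a * gnp_exp p g.
Proof. by rewrite /gnp_exp mulr_sumr; apply: eq_bigr => E _; rewrite mulrCA. Qed.

Lemma gnp_expD (R : realType) (n : nat) (p : R) (g h : graph n -> R) :
  gnp_exp p (fun E => g E + h E) = gnp_exp p g + gnp_exp p h.
Proof. by rewrite /gnp_exp -big_split; apply: eq_bigr => E _; rewrite mulrDr. Qed.

Definition pairs (n : nat) : {set {set 'I_n}} := [set e : {set 'I_n} | #|e| == 2%N].

Lemma card_pairs (n : nat) : #|pairs n| = 'C(n, 2).
Proof. by rewrite /pairs card_draws card_ord. Qed.

Lemma prodr_const_set (R : realType) (T : finType) (A : {set T}) (x : R) :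
  \prod_(e : T) (if e \in A then x else 1) = x ^+ #|A|.
Proof. by rewrite -big_mkcond prodr_const. Qed.

(** Independence: the two requirements concern disjoint families of pairs, and their joint indicator
    is a product over [e]. *)
Lemma gnp_exp_sub_disjoint (R : realType) (n : nat) (p : R) (F D : graph n) :
  F \subset pairs n -> D \subset pairs n -> [disjoint F & D] ->
  gnp_exp p (fun E => ((F \subset E) && [disjoint D & E])%:R) =
  p ^+ #|F| * (1 - p) ^+ #|D|.
Proof.
move=> /subsetP F2 /subsetP D2 dFD.
pose h (e : {set 'I_n}) (b : bool) : R := ((e \in F) ==> b)%:R * ((e \in D) ==> ~~ b)%:R.
rewrite (@eq_gnp_exp _ _ _ _ (fun E => \prod_e h e (e \in E))); last first.
  move=> E; case: (boolP (_ && _)) => [/andP[/subsetP FE dDE]|].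
    rewrite big1 // => e _; rewrite /h.
    have -> : (e \in F) ==> (e \in E) by apply/implyP; apply: FE.
    have -> : (e \in D) ==> (e \notin E).
      by apply/implyP => eD; rewrite (disjointFr dDE eD).
    by rewrite mulr1.
  rewrite negb_and => /orP[/subsetPn[e eF eE]|/pred0Pn[e /andP[/= eD eE]]].
    by rewrite (bigD1 e) //= /h eF (negbTE eE) !mul0r.
  by rewrite (bigD1 e) //= /h eD eE /= mulr0 mul0r.
rewrite gnp_exp_prod -!prodr_const_set -big_split /=; apply: eq_bigr => e _.
rewrite /h; have [eF|eF] /= := boolP (e \in F).
  rewrite (disjointFr dFD eF) /= /edge_weight.
  by move: (F2 e eF); rewrite inE => ->; rewrite !mulr1 !mulr0 ?mul0r ?addr0.
have [eD|eD] /= := boolP (e \in D).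
  move: (D2 e eD); rewrite inE => e2; rewrite /edge_weight e2.
  by rewrite !mulr1 !mulr0 ?mul0r ?add0r ?mul1r.
by rewrite !mulr1 edge_weightT.
Qed.

(** The probability generating function of a binomial variable; the Chernoff-type estimates below
    come from it. *)
Lemma gnp_exp_pow_card (R : realType) (n : nat) (p u : R) (X : graph n) :
  X \subset pairs n ->
  gnp_exp p (fun E => u ^+ #|E :&: X|) = (1 - p + p * u) ^+ #|X|.
Proof.
move=> /subsetP X2.
pose h (e : {set 'I_n}) (b : bool) : R := if b && (e \in X) then u else 1.
rewrite (@eq_gnp_exp _ _ _ _ (fun E => \prod_e h e (e \in E))); last first.
  move=> E; rewrite -prodr_const_set; apply: eq_bigr => e _; by rewrite inE.
rewrite gnp_exp_prod -prodr_const_set; apply: eq_bigr => e _.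
rewrite /h /=; case: ifPn => eX; last by rewrite !mulr1 edge_weightT.
by move: (X2 e eX); rewrite inE /edge_weight => ->; rewrite mulr1 addrC.
Qed.

(** Sprinkling: a pair is absent from the union of two independent graphs when it is absent from
    both, which has probability [(1 - p1) * (1 - p2)]. *)
Lemma gnp_exp_union (R : realType) (n : nat) (p p1 p2 : R) (g : graph n -> R) :
  1 - p = (1 - p1) * (1 - p2) ->
  gnp_exp p g = gnp_exp p1 (fun E1 => gnp_exp p2 (fun E2 => g (E1 :|: E2))).
Proof.
move=> hp; rewrite /gnp_exp.
transitivity (\sum_(E : graph n) \sum_(E1 : graph n) \sum_(E2 : graph n)
   gnp_weight p1 E1 * gnp_weight p2 E2 * (E1 :|: E2 == E)%:R * g E); last first.
  rewrite exchange_big; apply: eq_bigr => E1 _; rewrite exchange_big mulr_sumr.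
  apply: eq_bigr => E2 _; rewrite (bigD1 (E1 :|: E2)) //= eqxx mulr1 big1 ?addr0 ?mulrA //.
  by move=> E; rewrite eq_sym => /negbTE ->; rewrite mulr0 mul0r.
apply: eq_bigr => E _.
under eq_bigr do rewrite -mulr_suml.
rewrite -mulr_suml; congr (_ * _).
(* The indicator of [E1 :|: E2 == E] factors over [e], so the inner sums turn into products one
   after the other. *)
transitivity (\sum_(E1 : graph n) \prod_e (
     edge_weight p1 e (e \in E1) * edge_weight p2 e true * (((e \in E1) || true) == (e \in E))%:R +
     edge_weight p1 e (e \in E1) * edge_weight p2 e false * (((e \in E1) || false) == (e \in E))%:R)); last first.
  apply: eq_bigr => E1 _.
  rewrite -(sum_set_prod (fun e b => edge_weight p1 e (e \in E1) * edge_weight p2 e b *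
     (((e \in E1) || b) == (e \in E))%:R)).
  apply: eq_bigr => E2 _; rewrite 2!big_split /= -!gnp_weight_prod; congr (_ * _).
  have [<-|neE] := eqVneq.
    by rewrite big1 // => e _; rewrite inE eqxx.
  have [e he] : exists e, ((e \in E1) || (e \in E2)) != (e \in E).
    apply/existsP; rewrite -negb_forall; apply: contra neE => /forallP h.
    by apply/eqP/setP => e; rewrite in_setU; exact: (eqP (h e)).
  by rewrite (bigD1 e) //= (negbTE he) mul0r.
rewrite (sum_set_prod (fun e b => edge_weight p1 e b * edge_weight p2 e true * ((b || true) == (e \in E))%:R +
     edge_weight p1 e b * edge_weight p2 e false * ((b || false) == (e \in E))%:R)).
rewrite gnp_weight_prod; apply: eq_bigr => e _; rewrite /edge_weight.
case: (#|e| == 2%N); case: (e \in E) => /=; rewrite ?mulr0 ?mulr1 ?mul0r ?addr0 ?add0r //.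
have -> : p = 1 - (1 - p1) * (1 - p2) by rewrite -hp; ring.
by ring.
Qed.

(** * Balls and spanning forests *)

Definition ball (T : finType) (e : rel T) (A : {set T}) (k : nat) : {set T} :=
  iter k (fun X => X :|: [set w | [exists v in X, e v w]]) A.

Lemma ballS (T : finType) (e : rel T) (A : {set T}) (k : nat) (w : T) :
  reflect (w \in ball e A k \/ exists2 v, v \in ball e A k & e v w) (w \in ball e A k.+1).
Proof.
rewrite /ball /= in_setU inE; apply: (iffP orP) => -[h|h]; [by left| |by left|].
  by right; case/exists_inP: h => v; exists v.
by right; case: h => v vB vw; apply/exists_inP; exists v.
Qed.

Lemma sub_ballS (T : finType) (e : rel T) (A : {set T}) (k : nat) :
  ball e A k \subset ball e A k.+1.
Proof. by apply/subsetP => w wk; apply/ballS; left. Qed.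

Lemma sub_ball (T : finType) (e : rel T) (A : {set T}) (i j : nat) :
  (i <= j)%N -> ball e A i \subset ball e A j.
Proof.
move=> /subnK <-; elim: (j - i)%N => [|k IH]; first by rewrite add0n.
by rewrite addSn; apply: (subset_trans IH); apply: sub_ballS.
Qed.

Lemma ball_connect (T : finType) (e : rel T) (A : {set T}) (v w : T) :
  v \in A -> connect e v w -> exists k, w \in ball e A k.
Proof.
move=> vA /connectP[p]; elim/last_ind: p w => [|p x IH] w /=.
  by move=> _ ->; exists 0%N.
rewrite rcons_path last_rcons => /andP[pp lx] ->.
have [k hk] := IH _ pp erefl; exists k.+1; apply/ballS; right.
by exists (last v p).
Qed.

(* [par v = v] marks a root; vertices outside [S] are roots by convention. *)
Definition is_forest (n : nat) (E : graph n) (S : {set 'I_n}) (par : {ffun 'I_n -> 'I_n}) : Prop :=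
  [/\ forall v, v \notin S -> par v = v, forall v, v \in S -> par v \in S &
      exists d : 'I_n -> nat, forall v, par v != v ->
        (d (par v) < d v)%N /\ [set v; par v] \in E].

Definition forest_roots (n : nat) (S : {set 'I_n}) (par : {ffun 'I_n -> 'I_n}) : {set 'I_n} :=
  [set v in S | par v == v].

Definition forest_edges (n : nat) (S : {set 'I_n}) (par : {ffun 'I_n -> 'I_n}) : graph n :=
  [set [set v; par v] | v in S :\: forest_roots S par].

Definition induced (n : nat) (E : graph n) (S : {set 'I_n}) : rel 'I_n :=
  fun u v => [&& u \in S, v \in S & adj E u v].

Lemma adjC (n : nat) (E : graph n) : symmetric (adj E).
Proof. by move=> u v; rewrite /adj eq_sym setUC. Qed.

Lemma inducedC (n : nat) (E : graph n) (S : {set 'I_n}) : symmetric (induced E S).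
Proof. by move=> u v; rewrite /induced adjC andbCA. Qed.

Lemma connect_induced_sub (n : nat) (E : graph n) (S : {set 'I_n}) (v w : 'I_n) :
  v \in S -> connect (induced E S) v w -> w \in S.
Proof.
move=> vS /connectP[p]; elim: p v vS => [|x p IH] v vS /=; first by move=> _ ->.
by case/andP => /and3P[_ xS _] pp lw; apply: (IH x).
Qed.

(** If [v] and [w] differ, equality of the edges forces [par v = w] and [par w = v], and [d] would
    decrease around a 2-cycle. *)
Lemma forest_edge_inj (n : nat) (par : 'I_n -> 'I_n) (d : 'I_n -> nat) (v w : 'I_n) :
  (d (par v) < d v)%N -> (d (par w) < d w)%N -> [set v; par v] = [set w; par w] -> v = w.
Proof.
move=> dv dw /setP eqe; have := eqe v; rewrite !inE eqxx /=.
have [//|_ /= /esym/eqP vw] := eqVneq v w.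
have := eqe w; rewrite !inE eqxx /= => /orP[/eqP->//|/eqP wv].
by move: dv dw; rewrite -wv -vw => /ltnW; rewrite leqNgt => /negbTE ->.
Qed.

Lemma card_forest_edges (n : nat) (E : graph n) (S : {set 'I_n}) par :
  is_forest E S par -> #|forest_edges S par| = (#|S| - #|forest_roots S par|)%N.
Proof.
case=> _ _ [d hd]; rewrite /forest_edges card_in_imset; last first.
  move=> v w; rewrite !inE => /andP[nv vS] /andP[nw wS].
  move: nv nw; rewrite vS wS /= => nv nw.
  by apply: (@forest_edge_inj _ par d); [case: (hd v nv)|case: (hd w nw)].
by rewrite cardsDS //; apply/subsetP => v; rewrite inE => /andP[].
Qed.

Lemma forest_edges_sub (n : nat) (E : graph n) (S : {set 'I_n}) par :
  is_forest E S par -> forest_edges S par \subset E.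
Proof.
case=> _ _ [d hd]; apply/subsetP => e /imsetP[v]; rewrite !inE => /andP[nv vS] ->.
by move: nv; rewrite vS /= => /hd[].
Qed.

(** Breadth-first search in the graph induced on [S], started from one canonical vertex per
    component: each component has at most one root and at least [k] vertices. *)
Lemma exists_forest (n : nat) (E : graph n) (S : {set 'I_n}) (k : nat) :
  (forall v, v \in S -> (k <= #|[set w | connect (induced E S) v w]|)%N) ->
  exists2 par, is_forest E S par & (#|forest_roots S par| * k <= #|S|)%N.
Proof.
move=> hk; set e := induced E S.
have symc : connect_sym e := sym_connect_sym (@inducedC n E S).
pose Rt := [set fingraph.root e v | v in S].
have RtS : Rt \subset S.
  apply/subsetP => _ /imsetP[v vS ->].
  by apply: (connect_induced_sub vS); apply: connect_root.
(* On [S], [d] is the distance to [Rt]; it serves as the depth that makes [par] acyclic. *)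
have ex_d v : exists d, v \in S -> v \in ball e Rt d /\ forall j, v \in ball e Rt j -> (d <= j)%N.
  have [vS|_] := boolP (v \in S); last by exists 0%N.
  have ex : exists j, v \in ball e Rt j.
    apply: (@ball_connect _ _ _ (fingraph.root e v)); first exact: imset_f.
    by rewrite symc; apply: connect_root.
  by case: (ex_minnP ex) => d h1 h2; exists d.
have [d hd] := choice ex_d.
have ex_p v : exists u, if v \in S :\: Rt then e u v && (d u < d v)%N else u == v.
  have [|_] := boolP (v \in S :\: Rt); last by exists v.
  rewrite inE => /andP[vRt vS]; have [] := hd v vS.
  case: (d v) => [|j]; first by rewrite /ball /= (negbTE vRt).
  case/ballS => [vj hj|[u uj uv] _]; first by have := hj _ vj; rewrite ltnn.
  exists u; rewrite uv /= ltnS; have uS : u \in S by case/and3P: uv.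
  by apply: (hd u uS).2.
have [par0 hpar0] := choice ex_p; pose par := [ffun v => par0 v].
have parE v : par v = par0 v by rewrite ffunE.
have rootsE : forest_roots S par \subset Rt.
  apply/subsetP => v; rewrite inE parE => /andP[vS /eqP pv].
  have := hpar0 v; rewrite inE vS andbT; case: (v \in Rt) => //=.
  by rewrite pv ltnn andbF.
exists par.
  split=> [v vS|v vS|]; rewrite ?parE.
  - by have := hpar0 v; rewrite inE (negbTE vS) andbF => /eqP.
  - by have := hpar0 v; case: ifP => _ => [/andP[/and3P[]]|/eqP->].
  exists d => v; rewrite parE; have := hpar0 v; case: ifP => _; last by move/eqP->; rewrite eqxx.
  by case/andP=> /and3P[_ _ /andP[_ uv]] duv _; rewrite duv setUC.
apply: (@leq_trans (#|Rt| * k)); first by rewrite leq_mul2r (subset_leq_card rootsE) orbT.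
rewrite -sum_nat_const -[X in (_ <= X)%N]sum1_card.
rewrite [X in (_ <= X)%N](partition_big (fingraph.root e) (fun t => t \in Rt)) /=; last by move=> v vS; apply/imsetP; exists v.
apply: leq_sum => t tRt; rewrite sum1dep_card.
have tS : t \in S by apply: (subsetP RtS).
apply: (leq_trans (hk t tS)); apply: subset_leq_card; apply/subsetP => w.
rewrite !inE => tw; rewrite (connect_induced_sub tS tw) /=.
case/imsetP: tRt tw => v vS -> tw.
by rewrite (root_connect symc) symc; apply: connect_trans tw; apply: connect_root.
Qed.

Lemma leq_card_bigcup (I T : finType) (P : pred I) (F : I -> {set T}) :
  (#|\bigcup_(i | P i) F i| <= \sum_(i | P i) #|F i|)%N.
Proof.
elim/big_rec2: _ => [|i m A _ IH]; first by rewrite cards0.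
by rewrite cardsU; apply: (leq_trans (leq_subr _ _)); rewrite leq_add2l.
Qed.

(** With the [E2]-edges of the forest deleted, every vertex of [A] is joined in [E1] to a root or to
    the child end of an [E2]-edge. So at most [#|forest_roots A par| + #|E2|] components of [E1]
    meet [A]. *)
Lemma forest_small_components (n : nat) (E1 E2 : graph n) (A : {set 'I_n}) par (M : nat) :
  is_forest (E1 :|: E2) A par ->
  (#|[set v in A | #|component E1 v| < M]| <= M * (#|forest_roots A par| + #|E2|))%N.
Proof.
case=> hout hin [d hd].
pose Q := [set v in A | (par v != v) && ([set v; par v] \in E2)].
have cQ : (#|Q| <= #|E2|)%N.
  rewrite -(@card_in_imset _ _ (fun v => [set v; par v])).
    apply: subset_leq_card; apply/subsetP => e /imsetP[v].
    by rewrite inE => /and3P[_ _ ?] ->.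
  move=> v w; rewrite !inE => /and3P[_ nv _] /and3P[_ nw _].
  by apply: (@forest_edge_inj _ par d); [case: (hd v nv)|case: (hd w nw)].
have symc : connect_sym (adj E1) := sym_connect_sym (@adjC n E1).
(* Climb towards the root, by induction on the depth, and stop at the first edge in [E2]. *)
have conn v : v \in A -> exists2 t, t \in forest_roots A par :|: Q & connect (adj E1) t v.
  have [m] := ubnP (d v); elim: m v => // m IH v; rewrite ltnS => dvm vA.
  have [pv|pv] := eqVneq (par v) v.
    by exists v; rewrite // !inE vA pv eqxx.
  have [e2|e2] := boolP ([set v; par v] \in E2).
    by exists v; rewrite // !inE vA pv e2 orbT.
  have [dp] := hd v pv; rewrite inE (negbTE e2) orbF => e1.
  have [t tR tp] := IH (par v) (leq_trans dp dvm) (hin v vA).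
  exists t => //; apply: (connect_trans tp); apply: connect1.
  by rewrite /adj pv setUC.
have sub : [set v in A | #|component E1 v| < M]%N \subset
   \bigcup_(t in forest_roots A par :|: Q) (if (#|component E1 t| < M)%N then component E1 t else set0).
  apply/subsetP => v; rewrite inE => /andP[vA vM].
  have [t tR tv] := conn v vA; apply/bigcupP; exists t => //.
  have -> : component E1 t = component E1 v.
    apply/setP => w; rewrite !inE; exact: (same_connect symc tv).
  by rewrite vM inE.
apply: (leq_trans (subset_leq_card sub)); apply: (leq_trans (leq_card_bigcup _ _)).
apply: (@leq_trans (\sum_(t in forest_roots A par :|: Q) M)).
  by apply: leq_sum => t _; case: ifP => [/ltnW//|_]; rewrite cards0.
rewrite sum_nat_const mulnC leq_mul2l; apply/orP; right.
by rewrite cardsU; apply: (leq_trans (leq_subr _ _)); rewrite leq_add2l.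
Qed.

(** * Expansion *)

Definition cross (n : nat) (S T : {set 'I_n}) : graph n :=
  [set [set u.1; u.2] | u in setX S T].

Lemma crossP (n : nat) (S T : {set 'I_n}) (e : {set 'I_n}) :
  reflect (exists v w, [/\ v \in S, w \in T & e = [set v; w]]) (e \in cross S T).
Proof.
apply: (iffP imsetP) => [[[v w]]|[v [w [vS wT ->]]]].
  by rewrite in_setX => /andP[/= vS wT] ->; exists v, w.
by exists (v, w); rewrite // in_setX vS.
Qed.

Lemma card_cross (n : nat) (S T : {set 'I_n}) :
  [disjoint S & T] -> #|cross S T| = (#|S| * #|T|)%N.
Proof.
move=> dST; rewrite /cross card_in_imset ?cardsX // => -[v w] [v' w'].
rewrite !in_setX /= => /andP[vS wT] /andP[vS' wT'] /setP eqe.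
have ne (a b : 'I_n) : a \in S -> b \in T -> (a == b) = false.
  by move=> aS bT; apply/eqP => ab; move: bT; rewrite -ab (disjointFr dST aS).
have := eqe v; rewrite !inE eqxx /= (ne v w') // orbF => /esym/eqP ->.
by have := eqe w; rewrite !inE eqxx orbT ![w == _]eq_sym (ne v' w) //= => /esym/eqP ->.
Qed.

Lemma cross_pairs (n : nat) (S T : {set 'I_n}) :
  [disjoint S & T] -> cross S T \subset pairs n.
Proof.
move=> dST; apply/subsetP => _ /crossP[v [w [vS wT ->]]]; rewrite inE cards2.
by have [vw|//] := eqVneq v w; move: wT; rewrite -vw (disjointFr dST vS).
Qed.

Definition inner_boundary (n : nat) (E : graph n) (S : {set 'I_n}) : {set 'I_n} :=
  [set v in S | [exists w, (w \notin S) && adj E v w]].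

(** The forest uses pairs inside [S], while vertices of [S :\: B] send no edge to [~: S]; these
    families of pairs are disjoint, so the probabilities multiply. *)
Lemma prob_forest_boundary (R : realType) (n : nat) (p : R) (S B : {set 'I_n}) par :
  0 <= p <= 1 -> B \subset S ->
  gnp_exp p (fun E => (`[< is_forest E S par >] && (inner_boundary E S == B))%:R) <=
  p ^+ (#|S| - #|forest_roots S par|) * ((1 - p) ^+ (n - #|S|)) ^+ (#|S| - #|B|).
Proof.
move=> p01 BS; have [p0 p1] := andP p01.
have rhs0 : 0 <= p ^+ (#|S| - #|forest_roots S par|) * ((1 - p) ^+ (n - #|S|)) ^+ (#|S| - #|B|).
  by rewrite mulr_ge0 ?exprn_ge0 // subr_ge0.
(* If [par] is a forest in no graph, for instance because it is cyclic, the left side is 0;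
   otherwise any witness [E0] yields the size of [F]. *)
have [[E0 fE0]|nof] := pselect (exists E0, is_forest E0 S par); last first.
  rewrite /gnp_exp big1 // => E _; case: asboolP => [fE|_]; last by rewrite mulr0.
  by case: nof; exists E.
set F := forest_edges S par; set D := cross (S :\: B) (~: S).
have dD : [disjoint S :\: B & ~: S].
  by rewrite -setI_eq0 setIDAC setICr set0D.
have cD : #|D| = ((#|S| - #|B|) * (n - #|S|))%N.
  by rewrite card_cross // cardsDS // [#|~: S|]cardsCs setCK card_ord.
have FS e : e \in F -> exists v w, [/\ v \in S, w \in S, v != w & e = [set v; w]].
  case/imsetP=> v; rewrite !inE => /andP[nv vS] ->; move: nv; rewrite vS /= => nv.
  by exists v, (par v); rewrite eq_sym; split=> //; case: fE0 => _ /(_ v vS).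
have F2 : F \subset pairs n.
  by apply/subsetP => e /FS[v [w [_ _ vw ->]]]; rewrite inE cards2 vw.
have dFD : [disjoint F & D].
  rewrite disjoint_subset; apply/subsetP => e /FS[v [w [vS wS _ ->]]].
  apply/negP => /crossP[v' [w' [_]]]; rewrite inE => wS' /setP/(_ w').
  by rewrite !inE eqxx orbT => /orP[] /eqP ww; move: wS'; rewrite ww ?vS ?wS.
rewrite -exprM mulnC -cD -(card_forest_edges fE0) -gnp_exp_sub_disjoint //; last exact: cross_pairs.
apply: gnp_exp_le => // E; rewrite ler_nat.
case: asboolP => [fE|//] /=; case: eqP => [iB|//] /=.
rewrite (forest_edges_sub fE) /= lt0b disjoint_subset; apply/subsetP => _ /crossP[v [w [vSB wS ->]]].
apply/negP => vw; move: vSB; rewrite inE -iB inE => /andP[+ vS]; rewrite vS /= => /negP; apply.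
apply/existsP; exists w; move: wS; rewrite inE => wS; rewrite wS /adj vw andbT.
by apply: contraNneq wS => <-.
Qed.

(** The sum runs over all maps of [S] to itself, cyclic ones included, so it factors over the
    vertices: each picks itself at weight [y] or another vertex at weight [p]. *)
Lemma sum_forest_weight (R : realType) (n : nat) (S : {set 'I_n}) (y p : R) :
  0 <= p -> 0 <= y ->
  \sum_(par in family (fun v => [pred u | if v \in S then u \in S else u == v]))
     y ^+ #|forest_roots S par| * p ^+ (#|S| - #|forest_roots S par|) <=
  (y + #|S|%:R * p) ^+ #|S|.
Proof.
move=> p0 y0.
pose Fw (v u : 'I_n) : R := if v \in S then (if u == v then y else p) else 1.
rewrite (eq_bigr (fun par : {ffun 'I_n -> 'I_n} => \prod_v Fw v (par v))); last first.
  move=> par _; rewrite -prodr_const_set -cardsDS; last first.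
    by apply/subsetP => v; rewrite inE => /andP[].
  rewrite -(prodr_const_set (S :\: _)) -big_split; apply: eq_bigr => v _ /=.
  rewrite /Fw !inE; case: (v \in S) => /=; rewrite ?andbF ?mulr1 //.
  by case: (par v == v); rewrite /= ?mulr1 ?mul1r.
rewrite -(bigA_distr_big_dep (fun v => [pred u | if v \in S then u \in S else u == v]) Fw).
rewrite -prodr_const_set; apply: ler_prod => v _; apply/andP; split.
  by apply: sumr_ge0 => u _; rewrite /Fw; case: ifP => // _; case: ifP.
rewrite /Fw; case: (boolP (v \in S)) => vS; last by rewrite big_pred1_eq.
rewrite (bigD1 v) //= eqxx lerD2l (eq_bigr (fun=> p)); last by move=> u /andP[_ /negbTE->].
apply: (@le_trans _ _ (\sum_(i in S) p)); last by rewrite sumr_const mulr_natl.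
by rewrite [leRHS](bigD1 v) //= lerDr.
Qed.

Lemma sum_subset_weight (R : realType) (T : finType) (S : {set T}) (z w : R) :
  \sum_(B : {set T} | B \subset S) z ^+ #|B| * w ^+ (#|S| - #|B|) = (z + w) ^+ #|S|.
Proof.
pose h (v : T) (b : bool) : R := if v \in S then (if b then z else w) else (~~ b)%:R.
rewrite -prodr_const_set (eq_bigr (fun v => h v true + h v false)); last first.
  by move=> v _; rewrite /h; case: (v \in S) => //=; rewrite add0r.
rewrite -sum_set_prod big_mkcond /=; apply: eq_bigr => B _.
case: ifPn => [BS|/subsetPn[v vB vS]]; last first.
  by rewrite (bigD1 v) //= /h (negbTE vS) vB mul0r.
rewrite -cardsDS // -2!prodr_const_set -big_split; apply: eq_bigr => v _ /=.
rewrite /h in_setD; case: (boolP (v \in B)) => vB /=.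
  by rewrite (subsetP BS) // mulr1.
by case: (v \in S); rewrite ?mul1r ?mulr1.
Qed.

(** Having few trees is measured by cost: the base of the power is the inverse of the weight that
    the first moment bound gives to a root, and undoing all these weights may cost at most
    [expR (eta * #|S|)]. *)
Definition poorly_expanding (R : realType) (n : nat) (lam eta eps : R) (E : graph n)
    (S : {set 'I_n}) : Prop :=
  exists par, [/\ is_forest E S par,
    (n%:R / (lam * #|S|%:R)) ^+ #|forest_roots S par| <= expR (eta * #|S|%:R) &
    #|inner_boundary E S|%:R <= eps * #|S|%:R].

(** Exponential Markov inequality. On the event, [expR ((eta + Z * eps) * #|S|)] times a weight [y]
    per root and [expR (- Z)] per boundary vertex is at least 1. After [prob_forest_boundary], the
    sums over [par] and [B] separate and have closed bounds. *)
Lemma prob_poorly_expanding (R : realType) (n : nat) (p lam eta eps Z : R) (S : {set 'I_n}) :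
  0 <= p <= 1 -> 0 < lam -> 0 <= Z -> (0 < #|S|)%N ->
  gnp_exp p (fun E => `[< poorly_expanding lam eta eps E S >]%:R) <=
  (expR (eta + Z * eps) * ((lam * #|S|%:R / n%:R + #|S|%:R * p) *
     (expR (- Z) + (1 - p) ^+ (n - #|S|)))) ^+ #|S|.
Proof.
move=> p01 lam0 Z0 S0; have [p0 p1] := andP p01.
set s := #|S|; set y := lam * s%:R / n%:R; set z := expR (- Z); set w := (1 - p) ^+ (n - s).
have n0 : (0 < n)%N by apply: (leq_trans S0); rewrite -[X in (_ <= X)%N]card_ord max_card.
have y0 : 0 < y by rewrite divr_gt0 ?mulr_gt0 ?ltr0n.
have z0 : 0 < z by apply: expR_gt0.
have w0 : 0 <= w by rewrite exprn_ge0 // subr_ge0.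
pose fam := family (fun v => [pred u | if v \in S then u \in S else u == v]).
apply: (@le_trans _ _ (gnp_exp p (fun E => expR ((eta + Z * eps) * s%:R) *
   \sum_(par in fam) \sum_(B : {set 'I_n} | B \subset S) y ^+ #|forest_roots S par| * z ^+ #|B| *
     (`[< is_forest E S par >] && (inner_boundary E S == B))%:R))).
  apply: gnp_exp_le => // E; case: asboolP => [|_]; last first.
    rewrite mulr_ge0 ?expR_ge0 //; apply: sumr_ge0 => par _; apply: sumr_ge0 => B _.
    by rewrite !mulr_ge0 ?exprn_ge0 // ltW.
  case=> par [fE hr hB]; set B := inner_boundary E S in hB.
  have BS : B \subset S by apply/subsetP => v; rewrite inE => /andP[].
  have parF : par \in fam.
    apply/familyP => v; rewrite inE; case: ifPn => vS; first by case: fE => _ /(_ v vS).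
    by case: fE => /(_ v vS) ->.
  rewrite (bigD1 par) //= (bigD1 B) //= -/B eqxx andbT; case: asboolP => // _; rewrite mulr1.
  apply: (@le_trans _ _ (expR ((eta + Z * eps) * s%:R) * (y ^+ #|forest_roots S par| * z ^+ #|B|))); last first.
    rewrite ler_pM2l ?expR_gt0 // -addrA lerDl addr_ge0 //.
      by apply: sumr_ge0 => C _; rewrite !mulr_ge0 ?exprn_ge0 // ltW.
    by apply: sumr_ge0 => q _; apply: sumr_ge0 => C _; rewrite !mulr_ge0 ?exprn_ge0 // ltW.
  rewrite mulrDl expRD mulrACA.
  have h1 : 1 <= expR (eta * s%:R) * y ^+ #|forest_roots S par|.
    apply: (@le_trans _ _ ((n%:R / (lam * s%:R)) ^+ #|forest_roots S par| * y ^+ #|forest_roots S par|)).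
      have -> : n%:R / (lam * s%:R) = y^-1 by rewrite /y invf_div.
      by rewrite -exprMn mulVf ?expr1n // gt_eqF.
    by rewrite ler_wpM2r // exprn_ge0 // ltW.
  have h2 : 1 <= expR (Z * eps * s%:R) * z ^+ #|B|.
    rewrite /z -expRM_natr -expRD -[leLHS]expR0 ler_expR.
    by rewrite -mulrA mulNr -mulrBr mulr_ge0 // subr_ge0.
  by apply: mulr_ege1.
rewrite gnp_expZ gnp_exp_sum expRM_natr exprMn; apply: ler_wpM2l; first by rewrite exprn_ge0 ?expR_ge0.
under eq_bigr do rewrite gnp_exp_sum.
apply: (@le_trans _ _ (\sum_(par in fam) \sum_(B : {set 'I_n} | B \subset S)
   (y ^+ #|forest_roots S par| * p ^+ (s - #|forest_roots S par|)) * (z ^+ #|B| * w ^+ (s - #|B|)))).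
  apply: ler_sum => par _; apply: ler_sum => B BS; rewrite gnp_expZ mulrACA.
  by rewrite ler_wpM2l ?mulr_ge0 ?exprn_ge0 ?prob_forest_boundary // ltW.
under eq_bigr do rewrite -mulr_sumr sum_subset_weight.
rewrite -mulr_suml exprMn ler_wpM2r ?exprn_ge0 ?addr_ge0 //; first exact: ltW.
by apply: sum_forest_weight => //; apply: ltW.
Qed.

(** Combines ['C(n, s) <= n ^ s / s!] with [s ^ s <= s! * e ^ s]; the latter keeps a single term of
    the exponential series. *)
Lemma bin_exp_bound (R : realType) (n s : nat) (a : R) :
  0 <= a -> 'C(n, s)%:R * (a * s%:R / n%:R) ^+ s <= (expR 1 * a) ^+ s.
Proof.
move=> a0; have [->|n0] := posnP n.
  case: s => [|s]; first by rewrite bin0 !expr0 mulr1.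
  by rewrite bin0n mul0r exprn_ge0 ?mulr_ge0 ?expR_ge0.
have fact0 : 0 < (s`!)%:R :> R by rewrite ltr0n fact_gt0.
have ss : s%:R ^+ s <= (s`!)%:R * expR 1 ^+ s :> R.
  case: s fact0 => [|s] fact0; first by rewrite !expr0 mulr1.
  have := @expR_ge1Dxn R (s.+1)%:R s (ler0n _ _).
  rewrite -expRM_natl mulr1 => h; rewrite mulrC -ler_pdivrMr //.
  by apply: le_trans h; rewrite lerDr.
have cs : 'C(n, s)%:R * (s`!)%:R <= n%:R ^+ s :> R.
  rewrite -natrM bin_ffact -natrX ler_nat.
  elim: s {fact0 ss} => [|s IH]; first by rewrite ffactn0.
  by rewrite ffactnSr expnSr leq_mul // leq_subr.
rewrite !exprMn exprVn [a ^+ s * _]mulrC mulrA mulrA mulrAC ler_wpM2r ?exprn_ge0 //.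
rewrite ler_pdivrMr ?exprn_gt0 ?ltr0n //.
apply: (@le_trans _ _ ('C(n, s)%:R * ((s`!)%:R * expR 1 ^+ s))); first by rewrite ler_wpM2l.
by rewrite mulrA mulrC ler_wpM2l ?exprn_ge0 ?expR_ge0.
Qed.

(** * Union bound over all small vertex sets *)

Definition expanding (R : realType) (n : nat) (lam eta eps delta : R) (E : graph n) : Prop :=
  forall S : {set 'I_n}, (0 < #|S|)%N -> #|S|%:R <= delta * n%:R ->
  ~ poorly_expanding lam eta eps E S.

Lemma forest_roots_gt0 (n : nat) (E : graph n) (S : {set 'I_n}) par :
  is_forest E S par -> (0 < #|S|)%N -> (0 < #|forest_roots S par|)%N.
Proof.
case=> _ hin [d hd] /card_gt0P[v0 v0S].
case: (arg_minnP d v0S) => v vS hmin; apply/card_gt0P; exists v; rewrite inE (vS : v \in S) /=.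
apply: contraT => /hd[]; by rewrite ltnNge (hmin (par v) (hin v vS)).
Qed.

Lemma sum_geom_le (R : realType) (rho : R) (m k : nat) :
  0 <= rho < 1 -> \sum_(m <= i < k) rho ^+ i <= rho ^+ m / (1 - rho).
Proof.
case/andP=> r0 r1; have r2 : 0 < 1 - rho by rewrite subr_gt0.
have [mk|km] := leqP m k; last first.
  by rewrite big_geq ?divr_ge0 ?exprn_ge0 ?(ltW r2) // ltnW.
rewrite ler_pdivlMr //; apply: (@le_trans _ _ (rho ^+ m - rho ^+ k)); last first.
  by rewrite lerBlDr lerDl exprn_ge0.
rewrite -(subnKC mk); elim: (k - m)%N => [|j IH].
  by rewrite addn0 big_geq // mul0r subrr.
rewrite addnS big_nat_recr ?leq_addr //= mulrDl exprS; lra.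
Qed.

Lemma sum_sets_by_card (R : realType) (n s0 : nat) (F : nat -> R) :
  \sum_(S : {set 'I_n} | (s0 <= #|S|)%N) F #|S| =
  \sum_(s0 <= s < n.+1) 'C(n, s)%:R * F s.
Proof.
have cS (S : {set 'I_n}) : (#|S| < n.+1)%N by rewrite ltnS -[X in (_ <= X)%N]card_ord max_card.
rewrite big_geq_mkord /= (partition_big (fun S : {set 'I_n} => Ordinal (cS S)) (fun s => (s0 <= s)%N)) //=.
apply: eq_bigr => s hs.
rewrite (eq_bigl (fun S => S \in [set S : {set 'I_n} | #|S| == s :> nat])); last first.
  move=> S; rewrite inE -val_eqE /=; have [->|] := eqVneq; by rewrite ?andbT ?andbF.
rewrite (eq_bigr (fun=> F s)); last by move=> S; rewrite inE => /eqP->.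
by rewrite sumr_const card_draws card_ord mulr_natl.
Qed.

Lemma one_sub_expn_le (R : realType) (p : R) (k : nat) :
  p <= 1 -> (1 - p) ^+ k <= expR (- (p * k%:R)).
Proof.
move=> p1; rewrite -mulNr expRM_natr lerXn2r ?nnegrE ?subr_ge0 ?expR_ge0 //.
exact: expR_ge1Dx.
Qed.

(** Over sets of at least [s0] vertices the union bound is dominated by a geometric series of ratio
    [rho]. Smaller sets are never poor, because a single root is already too expensive for them. *)
Lemma prob_not_expanding (R : realType) (n s0 : nat) (p clo chi lam eta eps delta Z rho : R) :
  0 <= p <= 1 -> clo <= n%:R * p <= chi -> 0 <= clo -> 0 < lam <= 1 -> 0 <= Z -> 0 <= eta ->
  delta <= 1 -> lam * s0%:R * expR (eta * s0%:R) < n%:R ->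
  rho = expR 1 * (expR (eta + Z * eps) * ((lam + chi) * (expR (- Z) + expR (- (clo * (1 - delta)))))) ->
  rho < 1 ->
  gnp_exp p (fun E : graph n => `[< ~ expanding lam eta eps delta E >]%:R) <= rho ^+ s0 / (1 - rho).
Proof.
move=> p01 /andP[plo phi] clo0 /andP[lam0 lam1] Z0 eta0 delta1 hn rhoE rho1.
have [p0 p1] := andP p01.
have n0 : 0 < n%:R :> R by apply: le_lt_trans hn; rewrite !mulr_ge0 ?expR_ge0 // ltW.
have chi0 : 0 <= chi by apply: le_trans phi; rewrite mulr_ge0 // ltW.
set a := expR (eta + Z * eps) * ((lam + chi) * (expR (- Z) + expR (- (clo * (1 - delta))))) in rhoE.
have a0 : 0 <= a.
  by rewrite mulr_ge0 ?expR_ge0 // mulr_ge0 ?addr_ge0 ?expR_ge0 // ltW.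
have rho0 : 0 <= rho by rewrite rhoE mulr_ge0 ?expR_ge0.
apply: le_trans (sum_geom_le s0 n.+1 _); last by rewrite rho0.
apply: (@le_trans _ _ (gnp_exp p (fun E : graph n =>
   \sum_(S : {set 'I_n} | (s0 <= #|S|)%N)
     ((0 < #|S|)%N && (#|S|%:R <= delta * n%:R))%:R * `[< poorly_expanding lam eta eps E S >]%:R))).
  apply: gnp_exp_le => // E; case: asboolP => [|_]; last first.
    by apply: sumr_ge0 => S _; rewrite mulr_ge0.
  move=> /existsNP[S] /not_implyP[S0] /not_implyP[Sd] /contrapT poor.
  (* There is at least one root and the base is at least 1, so a poor [S] gives
     [n <= lam * #|S| * expR (eta * #|S|)], against the lower bound on [n]. *)
  have sS : (s0 <= #|S|)%N.
    rewrite leqNgt; apply/negP => ltS; case: poor => par [fE hr _].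
    have := forest_roots_gt0 fE S0; case: #|forest_roots S par| hr => // r hr _.
    have Sn : #|S|%:R <= n%:R :> R by rewrite ler_nat -[X in (_ <= X)%N]card_ord max_card.
    have lS0 : 0 < lam * #|S|%:R by rewrite mulr_gt0 ?ltr0n.
    have b1 : 1 <= n%:R / (lam * #|S|%:R).
      by rewrite ler_pdivlMr // mul1r; apply: le_trans Sn; rewrite ler_piMl.
    have : n%:R / (lam * #|S|%:R) <= expR (eta * #|S|%:R).
      by apply: le_trans hr; rewrite exprS ler_peMr ?exprn_ege1 // (le_trans _ b1).
    rewrite ler_pdivrMr //; apply/negP; rewrite -ltNge; apply: le_lt_trans hn.
    have ltS' : #|S|%:R <= s0%:R :> R by rewrite ler_nat ltnW.
    rewrite mulrC ler_pM ?expR_ge0 ?(ltW lS0) //; first by rewrite ler_pM2l.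
    by rewrite ler_expR ler_wpM2l.
  rewrite (bigD1 S) //= S0 Sd; case: asboolP => // _; rewrite mulr1 lerDl.
  by apply: sumr_ge0 => S' _; rewrite mulr_ge0.
rewrite gnp_exp_sum.
apply: (@le_trans _ _ (\sum_(S : {set 'I_n} | (s0 <= #|S|)%N) (a * #|S|%:R / n%:R) ^+ #|S|)).
  apply: ler_sum => S _; rewrite gnp_expZ.
  have as0 : 0 <= (a * #|S|%:R / n%:R) ^+ #|S|.
    by apply/exprn_ge0/divr_ge0 => //; apply: mulr_ge0.
  case: (boolP (_ && _)) => [/andP[S0 Sd]|_]; last by rewrite mul0r.
  have Sn : (#|S| <= n)%N by rewrite -[X in (_ <= X)%N]card_ord max_card.
  rewrite mul1r; apply: le_trans (prob_poorly_expanding _ _ p01 lam0 Z0 S0) _.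
  have w0 : 0 <= (1 - p) ^+ (n - #|S|) by rewrite exprn_ge0 // subr_ge0.
  have l0 : 0 <= lam * #|S|%:R / n%:R + #|S|%:R * p.
    by rewrite addr_ge0 ?mulr_ge0 ?invr_ge0 // ltW.
  apply: lerXn2r; rewrite ?nnegrE.
  - by apply: mulr_ge0; [exact: expR_ge0|apply: mulr_ge0 => //; rewrite addr_ge0 ?expR_ge0].
  - by apply: divr_ge0 => //; apply: mulr_ge0.
  rewrite /a -!mulrA ler_wpM2l ?expR_ge0 //.
  have -> : (lam + chi) * ((expR (- Z) + expR (- (clo * (1 - delta)))) * (#|S|%:R / n%:R)) =
     ((lam + chi) * (#|S|%:R / n%:R)) * (expR (- Z) + expR (- (clo * (1 - delta)))) by ring.
  apply: ler_pM.
  - by rewrite mulrA.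
  - by apply: addr_ge0 => //; apply: expR_ge0.
  - by rewrite mulrDl mulrA lerD2l mulrCA ler_wpM2l // ler_pdivlMr // mulrC //.
  (* As [S] misses at least [(1 - delta) * n] vertices, a given vertex has no neighbour outside [S]
     with probability at most [expR (- (clo * (1 - delta)))]. *)
  rewrite lerD2l; apply: le_trans (one_sub_expn_le _ p1) _; rewrite ler_expR lerN2.
  rewrite natrB // -(ler_pM2l n0).
  have h1 : (1 - delta) * n%:R <= n%:R - #|S|%:R by rewrite mulrBl mul1r lerD2l lerN2.
  have h2 : 0 <= (1 - delta) * n%:R by rewrite mulr_ge0 ?subr_ge0 // ltW.
  have -> : n%:R * (clo * (1 - delta)) = clo * ((1 - delta) * n%:R) by ring.
  by rewrite [leRHS]mulrA; apply: ler_pM.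
rewrite (sum_sets_by_card n s0 (fun s => (a * s%:R / n%:R) ^+ s)).
by apply: ler_sum => s _; rewrite rhoE; apply: bin_exp_bound.
Qed.

Lemma exists_nat_gt (R : realType) (x : R) : exists N : nat, x < N%:R.
Proof. by exists (Num.bound `|x|); apply: le_lt_trans (ler_norm x) (archi_boundP _). Qed.

Lemma exists_expn_le (R : realType) (t e : R) :
  0 < t -> 0 < e -> exists N : nat, forall n, (N <= n)%N -> expR (- (t * n%:R)) <= e.
Proof.
move=> t0 e0; have [N hN] := exists_nat_gt (e^-1 / t); exists N => n Nn.
rewrite expRN -[e]invrK lef_pV2 ?posrE ?invr_gt0 ?expR_gt0 //.
apply: le_trans (expR_ge1Dx _); apply: (@le_trans _ _ (t * n%:R)); last by rewrite lerDr.
rewrite mulrC -ler_pdivrMr //; apply: (le_trans (ltW hN)); by rewrite ler_nat.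
Qed.

(** Uniformity over a range of [n * p] matters because expansion is applied both to the full graph
    and to the slightly sparser graph present before sprinkling. *)
Lemma expanding_whp (R : realType) (clo chi : R) :
  0 < clo -> 0 < chi -> chi * expR (1 - clo) < 1 ->
  exists lam eta eps delta : R,
    [/\ 0 < lam <= 1, 0 < eta, 0 < eps < 1, 0 < delta < 1 &
     forall er, 0 < er -> exists N : nat, forall (n : nat) (p : R), (N <= n)%N ->
       0 <= p <= 1 -> clo <= n%:R * p <= chi ->
       gnp_exp p (fun E : graph n => `[< ~ expanding lam eta eps delta E >]%:R) <= er].
Proof.
move=> clo0 chi0 hlt.
have pos : 0 < chi * expR (1 - clo) by rewrite mulr_gt0 ?expR_gt0.
(* [4 * tau] is the logarithmic slack. The factor [lam + chi], the sum of exponentials governed by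
   [Z] and [delta], and [eta + Z * eps] each spend [tau] of it, which leaves
   [rho <= expR (- tau)]. *)
have [tau tau0 tauE] : exists2 tau, 0 < tau & chi * expR (1 - clo) = expR (- (4 * tau)).
  exists (- ln (chi * expR (1 - clo)) / 4).
    by rewrite divr_gt0 // oppr_gt0 ln_lt0 // pos.
  rewrite -[LHS]lnK ?posrE //; congr expR; lra.
pose lam := Num.min 1 (chi * tau).
have lam0 : 0 < lam by rewrite lt_min ltr01 mulr_gt0.
have lam1 : lam <= 1 by rewrite ge_min lexx.
have hlam : lam + chi <= chi * expR tau.
  apply: (@le_trans _ _ (chi * (1 + tau))); last by rewrite ler_pM2l ?expR_ge1Dx.
  by rewrite mulrDr mulr1 addrC lerD2l ge_min lexx orbT.
pose delta := Num.min (1/2) (tau / (2 * clo)).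
have delta0 : 0 < delta by rewrite lt_min; apply/andP; split; [lra|rewrite divr_gt0 ?mulr_gt0].
have delta1 : delta < 1 by rewrite gt_min; apply/orP; left; lra.
have hdelta : clo * delta <= tau / 2.
  have : delta <= tau / (2 * clo) by rewrite ge_min lexx orbT.
  by rewrite ler_pdivlMr ?mulr_gt0 // ler_pdivlMr //; lra.
(* [z] is the gap left after [delta] has used half of its [tau]; the cap at 1 keeps [Z]
   nonnegative. *)
pose z := Num.min 1 (expR (- clo + tau) - expR (- clo + tau / 2)).
have z0 : 0 < z by rewrite lt_min ltr01 subr_gt0 ltr_expR ltrD2l; lra.
pose Z := - ln z.
have Z0 : 0 <= Z by rewrite oppr_ge0 ln_le0 // ge_min lexx.
have hz : expR (- Z) + expR (- (clo * (1 - delta))) <= expR (- clo + tau).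
  rewrite opprK lnK ?posrE //.
  have h1 : z <= expR (- clo + tau) - expR (- clo + tau / 2) by rewrite ge_min lexx orbT.
  have h2 : expR (- (clo * (1 - delta))) <= expR (- clo + tau / 2) by rewrite ler_expR; lra.
  lra.
pose eps := Num.min (1/2) (tau / (2 * (Z + 1))).
have Z1 : 0 < Z + 1 by lra.
have eps0 : 0 < eps by rewrite lt_min; apply/andP; split; [lra|rewrite divr_gt0 ?mulr_gt0].
have eps1 : eps < 1 by rewrite gt_min; apply/orP; left; lra.
have heps : Z * eps <= tau / 2.
  apply: (@le_trans _ _ ((Z + 1) * eps)); first by rewrite ler_pM2r //; lra.
  have : eps <= tau / (2 * (Z + 1)) by rewrite ge_min lexx orbT.
  by rewrite ler_pdivlMr ?mulr_gt0 // ler_pdivlMr //; lra.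
pose eta := tau / 2.
have eta0 : 0 < eta by rewrite divr_gt0.
pose rho := expR 1 * (expR (eta + Z * eps) * ((lam + chi) * (expR (- Z) + expR (- (clo * (1 - delta)))))).
have rho_le : rho <= expR (- tau).
  apply: (@le_trans _ _ (expR 1 * (expR tau * ((chi * expR tau) * expR (- clo + tau))))); last first.
    have -> : expR 1 * (expR tau * (chi * expR tau * expR (- clo + tau))) =
      (chi * expR (1 - clo)) * (expR (3 * tau)).
      have -> : 3 * tau = tau + (tau + tau) by ring.
      by rewrite !expRD; ring.
    by rewrite tauE -expRD ler_expR; lra.
  rewrite ler_pM2l ?expR_gt0 // ler_pM ?expR_ge0 //.
  - by rewrite mulr_ge0 ?addr_ge0 ?expR_ge0 // ltW.
  - by rewrite ler_expR /eta; lra.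
  - by rewrite ler_pM ?addr_ge0 ?expR_ge0 // ltW.
have t1 : expR (- tau) < 1 by rewrite -[X in _ < X]expR0 ltr_expR oppr_lt0.
have rho1 : rho < 1 by apply: le_lt_trans t1.
have rho0 : 0 <= rho by rewrite !mulr_ge0 ?addr_ge0 ?expR_ge0 // ltW.
exists lam, eta, eps, delta; split; rewrite ?lam0 ?lam1 ?eps0 ?eps1 ?delta0 ?delta1 //.
move=> er er0; have r1 : 0 < 1 - rho by rewrite subr_gt0.
(* [s0] is fixed by the wanted error; [N] then exceeds the threshold that rules out poor sets
   smaller than [s0]. *)
have [s0 hs0] := exists_expn_le tau0 (mulr_gt0 er0 r1).
have [N hN] := exists_nat_gt (lam * s0%:R * expR (eta * s0%:R)); exists N => n p Nn p01 hp.
apply: (le_trans (@prob_not_expanding _ n s0 p clo chi lam eta eps delta Z rho _ _ _ _ _ _ _ _ _ _)) => //.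
- exact: ltW.
- by rewrite lam0.
- exact: ltW.
- exact: ltW.
- by apply: (lt_le_trans hN); rewrite ler_nat.
rewrite ler_pdivrMr //; apply: le_trans (hs0 s0 (leqnn _)).
by rewrite -mulNr expRM_natr lerXn2r ?nnegrE ?expR_ge0.
Qed.

(** * Robustness of the linear-size components *)

Lemma gnp_exp_le_simple (R : realType) (n : nat) (p : R) (g h : graph n -> R) :
  0 <= p <= 1 -> (forall E : graph n, E \subset pairs n -> g E <= h E) -> gnp_exp p g <= gnp_exp p h.
Proof.
move=> p01 gh; apply: ler_sum => E _.
have [sE|nsE] := boolP (simple_graph E); last by rewrite /gnp_weight (negbTE nsE) !mul0r.
rewrite ler_wpM2l ?gnp_weight_ge0 //; apply: gh; apply/subsetP => e eE.
by rewrite inE; apply: (forall_inP sE).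
Qed.

Lemma expR_half_le2 (R : realType) : expR (1 / 2) <= 2 :> R.
Proof.
have h : 1 / 2 <= expR (- (1 / 2)) :> R by apply: le_trans (expR_ge1Dx _); lra.
by rewrite -[leLHS]invrK -expRN -[leRHS]invrK lef_pV2 ?posrE ?invr_gt0 ?expR_gt0 //; lra.
Qed.

(** Chernoff bound with base 2: more than [2 * c * n] edges make [2 ^+ #|E|] at least
    [expR (c * n)], whereas its mean is at most [expR (c / 2 * n)]. *)
Lemma prob_many_edges (R : realType) (n : nat) (p c : R) :
  0 <= p <= 1 -> n%:R * p <= c ->
  gnp_exp p (fun E : graph n => (2 * c * n%:R < #|E|%:R)%R%:R) <= expR (- (c / 2 * n%:R)).
Proof.
move=> p01 npc; have [p0 p1] := andP p01.
apply: (@le_trans _ _ (gnp_exp p (fun E : graph n => expR (- (c * n%:R)) * 2 ^+ #|E :&: pairs n|))).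
  apply: gnp_exp_le_simple => // E /setIidPl ->.
  case: ltP => [hE|_] /=; last by rewrite mulr_ge0 ?expR_ge0 ?exprn_ge0.
  apply: (@le_trans _ _ (expR (- (c * n%:R)) * expR (1 / 2) ^+ #|E|)).
    rewrite -expRM_natr -expRD -[leLHS]expR0 ler_expR; lra.
  by rewrite ler_pM2l ?expR_gt0 // lerXn2r ?nnegrE ?expR_ge0 // expR_half_le2.
rewrite gnp_expZ gnp_exp_pow_card // card_pairs.
have -> : 1 - p + p * 2 = 1 + p by ring.
apply: (@le_trans _ _ (expR (- (c * n%:R)) * expR (p * 'C(n, 2)%:R))).
  rewrite ler_pM2l ?expR_gt0 // expRM_natr lerXn2r ?nnegrE ?expR_ge0 ?expR_ge1Dx //; lra.
rewrite -expRD ler_expR.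
have h : p * ('C(n, 2)%:R * 2) <= c * n%:R.
  apply: (@le_trans _ _ (p * (n%:R * n%:R))); last by rewrite mulrA ler_wpM2r // mulrC.
  rewrite ler_wpM2l // -!natrM ler_nat (_ : 2%N = 2`!) // bin_ffact ffactnS ffactn1.
  by rewrite leq_mul2l leq_pred orbT.
lra.
Qed.

(** * Components of linear size and their sparse cuts *)

Lemma in_cross_compl (n : nat) (D : {set 'I_n}) (v w : 'I_n) :
  ([set v; w] \in cross D (~: D)) = ((v \in D) != (w \in D)).
Proof.
apply/crossP/idP => [[v' [w' [vD]]]|].
  rewrite inE => wD /setP e; have := e v'; have := e w'.
  rewrite !inE !eqxx !orbT /= => /orP[]/eqP ww /orP[]/eqP vv; move: vD wD; rewrite ww vv;
    by case: (v \in D); case: (w \in D).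
case: (boolP (v \in D)) => vD; case: (boolP (w \in D)) => wD // _.
  by exists v, w; rewrite inE.
by exists w, v; rewrite inE setUC.
Qed.

Lemma component_eq (n : nat) (E : graph n) (v w : 'I_n) :
  connect (adj E) v w -> component E v = component E w.
Proof.
move=> vw; apply/setP => x; rewrite !inE.
exact: (same_connect (sym_connect_sym (@adjC n E)) vw).
Qed.

Definition closed_set (n : nat) (E : graph n) (U : {set 'I_n}) : bool :=
  [forall v in U, component E v \subset U].

Lemma closed_set_forest (n : nat) (E : graph n) (U : {set 'I_n}) (M : nat) :
  closed_set E U -> (forall v, v \in U -> (M <= #|component E v|)%N) ->
  exists2 par, is_forest E U par & (#|forest_roots U par| * M <= #|U|)%N.
Proof.
move=> /forall_inP cU hM; apply: exists_forest => v vU; apply: (leq_trans (hM v vU)).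
apply: subset_leq_card; apply/subsetP => w; rewrite !inE => /connectP[p].
elim: p v vU => [|x p IH] v vU /= => [_ ->//|/andP[vx pp] lw].
have xU : x \in U by apply: (subsetP (cU v vU)); rewrite inE connect1.
by apply: connect_trans (IH x xU pp lw); apply: connect1; rewrite /induced vU xU.
Qed.

Lemma closed_set_boundary (n : nat) (E : graph n) (U : {set 'I_n}) :
  closed_set E U -> inner_boundary E U = set0.
Proof.
move=> /forall_inP cU; apply/setP => v; rewrite !inE; apply/negP => /andP[vU /existsP[w /andP[wU vw]]].
by move/negP: wU; apply; apply: (subsetP (cU v vU)); rewrite inE connect1.
Qed.

(* Components of intermediate size have no boundary, so expansion bounds their total size. *)
Definition mid_vertices (R : realType) (n : nat) (E : graph n) (M : nat) (b : R) : {set 'I_n} :=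
  [set v | (M <= #|component E v|)%N && (#|component E v|%:R <= b)].

(** If the bound failed, take a largest union [U] of such components with at most [delta * n]
    vertices. It has no boundary, its trees average at least [M] vertices, and it still has at least
    [kappa * n] vertices, which contradicts expansion. *)
Lemma card_mid_vertices (R : realType) (n : nat) (E : graph n) (M : nat)
    (lam eta eps delta kappa : R) :
  expanding lam eta eps delta E -> 0 < lam -> 0 <= eta -> 0 <= eps -> 0 < kappa -> kappa <= delta / 2 ->
  (lam * kappa)^-1 <= expR (eta * M%:R) -> (0 < n)%N ->
  #|mid_vertices E M (delta / 2 * n%:R)|%:R < kappa * n%:R.
Proof.
move=> expE lam0 eta0 eps0 kappa0 kd hM n0; set mid := mid_vertices _ _ _.
have nR0 : 0 < n%:R :> R by rewrite ltr0n.
have mid_eq v w : v \in mid -> w \in component E v -> w \in mid.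
  by rewrite [w \in component _ _]inE => + /component_eq vw; rewrite !inE vw.
rewrite ltNge; apply/negP => hmid.
pose P (U : {set 'I_n}) := [&& closed_set E U, U \subset mid & #|U|%:R <= delta * n%:R].
have P0 : P set0.
  rewrite /P sub0set cards0 /=; apply/andP; split; first by apply/forall_inP => v; rewrite inE.
  by rewrite mulr_ge0 // ltW //; lra.
case: (@arg_maxnP _ set0 P (fun U => #|U|) P0) => U /and3P[cU Umid Ud] Umax.
(* Either [U] is everything, or one more component, of at most [delta / 2 * n] vertices, would push
   it past [delta * n]. *)
have Ukappa : kappa * n%:R <= #|U|%:R.
  have [midU|/subsetPn[v vmid vU]] := boolP (mid \subset U).
    by apply: (le_trans hmid); rewrite ler_nat subset_leq_card.
  pose U' := U :|: component E v.
  have cU' : closed_set E U'.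
    apply/forall_inP => w; rewrite inE => /orP[wU|wv].
      by apply: (subset_trans (forall_inP cU w wU)); apply: subsetUl.
    by move: wv; rewrite inE => /component_eq <-; apply: subsetUr.
  have U'mid : U' \subset mid.
    by rewrite subUset Umid /=; apply/subsetP => w; apply: mid_eq.
  have vc : #|component E v|%:R <= delta / 2 * n%:R by move: vmid; rewrite inE => /andP[].
  have cardU' : (#|U'| <= #|U| + #|component E v|)%N by rewrite cardsU leq_subr.
  have ltUU' : (#|U| < #|U'|)%N.
    apply: proper_card; apply/properP; split; first exact: subsetUl.
    by exists v; rewrite // !inE connect0 orbT.
  have nPU' : ~~ P U'.
    by apply/negP => PU'; have := Umax U' PU'; rewrite /= leqNgt ltUU'.
  move: nPU'; rewrite /P cU' U'mid /= -ltNge => hU'.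
  have h1 : #|U'|%:R <= #|U|%:R + #|component E v|%:R :> R by rewrite -natrD ler_nat.
  have h2 : kappa * n%:R <= delta / 2 * n%:R by rewrite ler_pM2r.
  lra.
have U0 : 0 < #|U|%:R :> R by apply: lt_le_trans Ukappa; rewrite mulr_gt0.
apply: (expE U) => //; first by rewrite ltr0n in U0.
have Mcomp v : v \in U -> (M <= #|component E v|)%N.
  by move=> vU; have := subsetP Umid v vU; rewrite inE => /andP[].
have [par fE hr] := closed_set_forest cU Mcomp.
exists par; split=> //; last by rewrite closed_set_boundary // cards0 mulr_ge0.
(* One root costs at most [(lam * kappa)^-1 <= expR (eta * M)], and there are at most [#|U| / M]
   roots. *)
apply: (@le_trans _ _ (expR (eta * M%:R) ^+ #|forest_roots U par|)).
  apply: lerXn2r; rewrite ?nnegrE ?expR_ge0 //.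
    by rewrite divr_ge0 // mulr_ge0 // ltW.
  apply: le_trans hM; rewrite !invfM mulrCA ler_pM2l ?invr_gt0 //.
  by rewrite ler_pdivrMr // mulrC ler_pdivlMr // mulrC.
rewrite -expRM_natr ler_expR -mulrA ler_wpM2l // -natrM ler_nat mulnC //.
Qed.

Definition large_vertices (R : realType) (n : nat) (E : graph n) (b : R) : {set 'I_n} :=
  [set v | b < #|component E v|%:R].

Lemma card_large_of_forest (R : realType) (n : nat) (E1 E2 : graph n) (A : {set 'I_n}) par
    (M : nat) (b : R) :
  is_forest (E1 :|: E2) A par ->
  (#|A| <= #|A :&: large_vertices E1 b| + #|mid_vertices E1 M b| +
     M * (#|forest_roots A par| + #|E2|))%N.
Proof.
move=> fE; have := forest_small_components M fE.
set sm := [set v in A | _] => hsm.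
have sub : A \subset (A :&: large_vertices E1 b) :|: mid_vertices E1 M b :|: sm.
  apply/subsetP => v vA; rewrite !inE vA /=.
  by case: (ltnP #|component E1 v| M) => _ /=; rewrite ?orbT // orbF; case: ltP.
apply: (leq_trans (subset_leq_card sub)).
apply: (leq_trans (_ : _ <= #|(A :&: large_vertices E1 b) :|: mid_vertices E1 M b| + #|sm|)%N).
  by rewrite cardsU leq_subr.
by rewrite leq_add // cardsU leq_subr.
Qed.

(** The roots stand for the components with more than [b] vertices, and these are pairwise
    disjoint. *)
Lemma card_large_roots (R : realType) (n : nat) (E : graph n) (b : R) :
  0 <= b ->
  #|[set fingraph.root (adj E) v | v in large_vertices E b]|%:R * b <= n%:R.
Proof.
move=> b0; set L := large_vertices E b; set Rt := [set _ | v in L].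
have symc : connect_sym (adj E) := sym_connect_sym (@adjC n E).
apply: (@le_trans _ _ (\sum_(t in Rt) #|component E t|%:R)).
  rewrite mulr_natl -sumr_const; apply: ler_sum => _ /imsetP[v vL ->].
  rewrite -(component_eq (connect_root _ v)); apply: ltW.
  by move: vL; rewrite inE.
rewrite -natr_sum ler_nat -[X in (_ <= X)%N]card_ord -sum1_card.
rewrite [X in (_ <= X)%N](partition_big (fingraph.root (adj E)) predT) //= [X in (_ <= X)%N](bigID (mem Rt)) /=.
apply: (leq_trans _ (leq_addr _ _)); apply: leq_sum => _ /imsetP[v vL ->].
rewrite sum1dep_card; apply: subset_leq_card; apply/subsetP => w; rewrite !inE => vw.
by rewrite (root_connect symc) symc; apply: connect_trans vw; apply: connect_root.
Qed.

(** Along an edge, membership in [D] changes exactly when the edge belongs to the cut. With equal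
    cuts, agreement of [D] and [D'] therefore propagates over components, and it holds at the
    roots. *)
Lemma cut_determined (R : realType) (n : nat) (E : graph n) (b : R) (D D' : {set 'I_n}) :
  let L := large_vertices E b in
  let Rt := [set fingraph.root (adj E) v | v in L] in
  D \subset L -> D' \subset L ->
  E :&: cross D (~: D) = E :&: cross D' (~: D') -> D :&: Rt = D' :&: Rt -> D = D'.
Proof.
move=> L Rt DL DL' /setP eqX /setP eqR.
pose a := [pred v | (v \in D) == (v \in D')].
have cl : closed (adj E) a.
  move=> v w /andP[vw eE]; have := eqX [set v; w].
  rewrite !inE eE /= !in_cross_compl.
  by do 4 case: (_ \in _).
apply/setP => v; have [vL|vL] := boolP (v \in L); last first.
  by rewrite !(contraNF (subsetP _ v) vL).
have : fingraph.root (adj E) v \in a.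
  have rR : fingraph.root (adj E) v \in Rt by apply: imset_f.
  by have := eqR (fingraph.root (adj E) v); rewrite !inE rR !andbT => ->.
by rewrite -(closed_connect cl (connect_root _ v)) => /eqP.
Qed.

(** Weigh [F] by [expR (- U) ^+ #|F|]: each counted set has weight at least [expR (- (U * t))], and
    the total weight is [(1 + expR (- U)) ^+ #|E|]. *)
Lemma card_small_subsets (R : realType) (T : finType) (E : {set T}) (U t : R) :
  0 <= U ->
  #|[set F : {set T} | (F \subset E) && (#|F|%:R <= t)]|%:R <= expR (expR (- U) * #|E|%:R + U * t).
Proof.
move=> U0; rewrite expRD mulrC.
apply: (@le_trans _ _ (expR (U * t) * \sum_(F : {set T} | F \subset E) expR (- U) ^+ #|F| * 1 ^+ (#|E| - #|F|))).
  rewrite -sum1_card natr_sum mulr_sumr [leRHS](bigID (fun F : {set T} => #|F|%:R <= t)) /=.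
  rewrite -[leLHS]addr0; apply: lerD; last first.
    by apply: sumr_ge0 => F _; rewrite expr1n mulr1 mulr_ge0 ?exprn_ge0 ?expR_ge0.
  rewrite [leRHS](eq_bigl (mem [set F : {set T} | (F \subset E) && (#|F|%:R <= t)])); last by move=> F; rewrite !inE.
  apply: ler_sum => F; rewrite inE => /andP[_ Ft].
  rewrite expr1n mulr1 -expRM_natr -expRD -[leLHS]expR0 ler_expR.
  by rewrite mulNr -mulrBr mulr_ge0 ?subr_ge0.
rewrite sum_subset_weight ler_pM2l ?expR_gt0 // expRM_natr.
by rewrite lerXn2r ?nnegrE ?addr_ge0 ?expR_ge0 // addrC expR_ge1Dx.
Qed.

(** Connectedness of [A] and [B] would be too much to ask: balls around a scattered set have many
    components, and only the average tree size, at least [l], is under control. *)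
Definition robust (R : realType) (n : nat) (delta : R) (l : nat) (e2 : R) (E : graph n) : Prop :=
  forall (S A B : {set 'I_n}) parA parB, A \subset S -> B \subset ~: S ->
    is_forest E A parA -> is_forest E B parB ->
    delta * n%:R <= #|A|%:R -> delta * n%:R <= #|B|%:R ->
    (l * #|forest_roots A parA| <= #|A|)%N -> (l * #|forest_roots B parB| <= #|B|)%N ->
    e2 * n%:R < #|E :&: cross S (~: S)|%:R.

Definition sparse_cuts (R : realType) (n : nat) (E : graph n) (b t : R) : {set {set 'I_n}} :=
  [set D : {set 'I_n} | (D \subset large_vertices E b) && (#|E :&: cross D (~: D)|%:R <= t)].

(** By [cut_determined] a sparse cut is encoded by its trace on the roots, one bit for each of at
    most [k] large components, and by its few edges. *)
Lemma card_sparse_cuts (R : realType) (n k : nat) (E : graph n) (b t U : R) :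
  0 <= U -> 0 < b -> n%:R <= k%:R * b ->
  #|sparse_cuts E b t|%:R <= 2 ^+ k * expR (expR (- U) * #|E|%:R + U * t).
Proof.
move=> U0 b0 hk; set L := large_vertices E b; set Rt := [set fingraph.root (adj E) v | v in L].
set K := sparse_cuts E b t; set F := [set F : {set {set 'I_n}} | (F \subset E) && (#|F|%:R <= t)].
have cRt : (#|Rt| <= k)%N.
  rewrite -(ler_nat R) -(ler_pM2r b0); apply: le_trans hk.
  by apply: card_large_roots; apply: ltW.
have cK : (#|K| <= 2 ^ #|Rt| * #|F|)%N.
  rewrite -card_powerset -cardsX.
  rewrite -(@card_in_imset _ _ (fun D => (D :&: Rt, E :&: cross D (~: D))) K); last first.
    move=> D D'; rewrite !inE => /andP[DL _] /andP[DL' _] [eR eX].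
    exact: (cut_determined DL DL' eX eR).
  apply: subset_leq_card; apply/subsetP => _ /imsetP[D DK ->]; move: DK; rewrite inE => /andP[_ Dt].
  by rewrite in_setX !inE subsetIr subsetIl Dt.
apply: (@le_trans _ _ (2 ^+ #|Rt| * #|F|%:R)).
  by rewrite -natrX -natrM ler_nat.
apply: ler_pM; rewrite ?exprn_ge0 //; last exact: card_small_subsets.
by rewrite -!natrX ler_nat leq_exp2l.
Qed.

(** The witness is [S :&: L]. Since [L] is a union of components of [E1], the restriction creates no
    new cut edge of [E1], and the [E2]-edges between [D] and [L :\: D] already cross [S]. *)
Lemma not_robust_sparse_cut (R : realType) (n : nat) (E1 E2 : graph n) (delta e2 : R) (M : nat) :
  0 < delta -> (0 < M)%N ->
  #|mid_vertices E1 M (delta / 2 * n%:R)|%:R <= delta / 8 * n%:R ->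
  8 * M%:R * #|E2|%:R <= delta * n%:R ->
  ~ robust delta (8 * M) e2 (E1 :|: E2) ->
  let L := large_vertices E1 (delta / 2 * n%:R) in
  exists2 D, D \in sparse_cuts E1 (delta / 2 * n%:R) (e2 * n%:R) &
    [/\ delta / 2 * n%:R <= #|D|%:R, delta / 2 * n%:R <= #|L :\: D|%:R &
        #|E2 :&: cross D (L :\: D)|%:R <= e2 * n%:R].
Proof.
move=> delta0 M0 hmid hE2 nrob L.
have [S [A [B [parA [parB [AS BS fA fB [cA cB rA rB hcut]]]]]]] :
  exists (S A B : {set 'I_n}) parA parB, [/\ A \subset S, B \subset ~: S,
    is_forest (E1 :|: E2) A parA, is_forest (E1 :|: E2) B parB & [/\
    delta * n%:R <= #|A|%:R, delta * n%:R <= #|B|%:R,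
    (8 * M * #|forest_roots A parA| <= #|A|)%N, (8 * M * #|forest_roots B parB| <= #|B|)%N &
    #|(E1 :|: E2) :&: cross S (~: S)|%:R <= e2 * n%:R]].
  apply: contrapT => nex; apply: nrob => S A B parA parB AS BS fA fB cA cB rA rB.
  rewrite ltNge; apply/negP => hcut; apply: nex.
  by exists S, A, B, parA, parB.
(* At most [delta / 8 * n] vertices are lost to intermediate components, as many to [E2], and
   [#|C| / 8] to the roots; at least half of [delta * n] remains. *)
have large (C : {set 'I_n}) par : is_forest (E1 :|: E2) C par -> delta * n%:R <= #|C|%:R ->
    (8 * M * #|forest_roots C par| <= #|C|)%N -> delta / 2 * n%:R <= #|C :&: L|%:R.
  move=> fC cC rC; have := card_large_of_forest M (delta / 2 * n%:R) fC; rewrite -/L.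
  rewrite -(ler_nat R) !natrD natrM natrD => h1.
  have h2 : 8 * (M%:R * #|forest_roots C par|%:R) <= #|C|%:R :> R by rewrite -!natrM ler_nat mulnA.
  have h3 : 0 <= delta * n%:R by rewrite mulr_ge0 // ltW.
  lra.
have subL v w : adj E1 v w -> (v \in L) = (w \in L).
  by move=> vw; rewrite !inE (component_eq (connect1 vw)).
pose D := S :&: L.
have le_cut (F : graph n) : F \subset (E1 :|: E2) :&: cross S (~: S) -> #|F|%:R <= e2 * n%:R.
  by move=> FX; apply: le_trans hcut; rewrite ler_nat subset_leq_card.
exists D; first rewrite inE subsetIr /=; last split.
- apply: le_cut; apply/subsetP => e; rewrite in_setI => /andP[eE1 /crossP[v [w [vD wD ee]]]].
  rewrite ee in eE1 *; rewrite in_setI in_setU eE1 /= in_cross_compl.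
  move: vD wD; rewrite in_setC !in_setI => /andP[vS vL] /nandP wSL; rewrite vS.
  have vw : v != w by apply/eqP => vw; move: wSL; rewrite -vw vS vL => -[].
  have := subL v w; rewrite /adj vw eE1 => /(_ isT) vwL.
  by case: wSL => [/negbTE->//|]; rewrite -vwL vL.
- apply: (le_trans (large A parA fA cA rA)); rewrite ler_nat subset_leq_card //.
  by apply: setSI.
- apply: (le_trans (large B parB fB cB rB)); rewrite ler_nat subset_leq_card //.
  apply/subsetP => v; rewrite in_setD !in_setI => /andP[vB ->]; rewrite !andbT.
  by have := subsetP BS v vB; rewrite inE => /negbTE ->.
- apply: le_cut; apply/subsetP => e; rewrite in_setI => /andP[eE2 /crossP[v [w [vD wD ee]]]].
  rewrite ee in eE2 *; rewrite in_setI in_setU eE2 orbT /= in_cross_compl.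
  move: vD wD; rewrite in_setD !in_setI => /andP[-> _] /andP[+ wL]; by rewrite wL andbT => /negbTE ->.
Qed.

(** Union bound over [K]. For fixed [D] at least [b * b] pairs join [D] to [L :\: D], and each
    contributes a factor [1 - p + p * expR (- 1) <= expR (- (p / 2))] to the exponential moment. *)
Lemma prob_sparse_cut (R : realType) (n : nat) (p b t : R) (K : {set {set 'I_n}}) (L : {set 'I_n}) :
  0 <= p <= 1 -> 0 <= b ->
  gnp_exp p (fun E : graph n => [exists D in K, [&& b <= #|D|%:R, b <= #|L :\: D|%:R &
     #|E :&: cross D (L :\: D)|%:R <= t]]%:R) <=
  #|K|%:R * expR (t - p * (b * b) / 2).
Proof.
move=> p01 b0; have [p0 p1] := andP p01.
pose Q (D : {set 'I_n}) := (b <= #|D|%:R) && (b <= #|L :\: D|%:R).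
apply: (@le_trans _ _ (gnp_exp p (fun E : graph n => \sum_(D in K)
    expR t * ((Q D)%:R * expR (- 1) ^+ #|E :&: cross D (L :\: D)|)))).
  apply: gnp_exp_le => // E; case: (boolP [exists D in K, _]) => [|_]; last first.
    by apply: sumr_ge0 => D _; rewrite !mulr_ge0 ?exprn_ge0 ?expR_ge0.
  case/exists_inP => D DK /and3P[h1 h2 h3]; rewrite (bigD1 D) //= /Q h1 h2 mul1r.
  rewrite -[leLHS]addr0; apply: lerD.
    by rewrite -expRM_natr -expRD -[leLHS]expR0 ler_expR mulN1r subr_ge0.
  by apply: sumr_ge0 => D' _; rewrite !mulr_ge0 ?exprn_ge0 ?expR_ge0.
rewrite gnp_exp_sum mulr_natl -sumr_const; apply: ler_sum => D _.
rewrite gnp_expZ gnp_expZ expRD ler_pM2l ?expR_gt0 //.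
case: (boolP (Q D)) => [/andP[h1 h2]|_]; last by rewrite mul0r expR_ge0.
have dD : [disjoint D & L :\: D] by rewrite -setI_eq0 setIDA setIC setDE -setIA setICr setI0.
rewrite mul1r gnp_exp_pow_card ?cross_pairs // card_cross //.
have e1 : expR (- 1) <= 1 / 2 :> R.
  have h : 2 <= expR 1 :> R by apply: le_trans (expR_ge1Dx _); lra.
  by rewrite expRN -[leRHS]invrK lef_pV2 ?posrE ?expR_gt0 //; lra.
have e0 := expR_ge0 (- 1 : R).
apply: (@le_trans _ _ (expR (- (p / 2) * (#|D| * #|L :\: D|)%:R))).
  rewrite expRM_natr lerXn2r ?nnegrE ?expR_ge0 //.
    by rewrite addr_ge0 ?subr_ge0 // mulr_ge0.
  apply: le_trans (expR_ge1Dx _).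
  have : p * expR (- 1) <= p * (1 / 2) by rewrite ler_wpM2l.
  lra.
rewrite ler_expR natrM.
have : b * b <= #|D|%:R * #|L :\: D|%:R by rewrite ler_pM.
move=> h; have : p * (b * b) <= p * (#|D|%:R * #|L :\: D|%:R) by rewrite ler_wpM2l.
lra.
Qed.

(** * Robustness by sprinkling a second, sparser graph *)

Lemma gnp_exp_const (R : realType) (n : nat) (p a : R) : gnp_exp p (fun _ : graph n => a) = a.
Proof.
rewrite (@eq_gnp_exp _ _ _ _ (fun=> a * 1)); last by move=> E; rewrite mulr1.
by rewrite gnp_expZ gnp_exp1 mulr1.
Qed.

(** Only [E2] is random here. In the exponent, [2 * c * expR (- U) + U * e2] counts the sparse cuts
    of [E1], while one more [e2] and the gain [c2 * delta ^+ 2 / 8] come from [prob_sparse_cut]. The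
    last summand accounts for too many edges in [E2]. *)
Lemma prob_not_robust_given (R : realType) (n M k : nat) (E1 : graph n)
    (lam eta eps delta p c c2 e2 U : R) :
  0 <= p <= 1 -> n%:R * p = c2 -> (0 < n)%N -> (0 < M)%N -> 16 * M%:R * c2 <= delta ->
  expanding lam eta eps delta E1 -> 0 < lam -> 0 <= eta -> 0 <= eps -> 0 < delta ->
  (lam * (delta / 8))^-1 <= expR (eta * M%:R) ->
  #|E1|%:R <= 2 * c * n%:R -> 0 <= U -> 2 <= k%:R * delta ->
  gnp_exp p (fun E2 => `[< ~ robust delta (8 * M) e2 (E1 :|: E2) >]%:R) <=
  2 ^+ k * expR ((2 * c * expR (- U) + (U + 1) * e2 - c2 * delta ^+ 2 / 8) * n%:R) +
  expR (- (c2 / 2 * n%:R)).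
Proof.
move=> p01 np n0 M0 hc2 expE lam0 eta0 eps0 delta0 hM hE1 U0 hk.
have nR : 0 < n%:R :> R by rewrite ltr0n.
have MR : 0 < M%:R :> R by rewrite ltr0n.
set b := delta / 2 * n%:R.
have b0 : 0 < b by rewrite mulr_gt0 // divr_gt0.
have hmid : #|mid_vertices E1 M b|%:R <= delta / 8 * n%:R.
  by apply/ltW/(card_mid_vertices expE) => //; lra.
set L := large_vertices E1 b; set K := sparse_cuts E1 b (e2 * n%:R).
apply: (@le_trans _ _ (gnp_exp p (fun E2 : graph n =>
   [exists D in K, [&& b <= #|D|%:R, b <= #|L :\: D|%:R &
     #|E2 :&: cross D (L :\: D)|%:R <= e2 * n%:R]]%:R + (2 * c2 * n%:R < #|E2|%:R)%R%:R))).
  apply: gnp_exp_le => // E2; case: asboolP => [nrob|_]; last by rewrite addr_ge0.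
  case: ltP => hE2; first by rewrite lerDr.
  rewrite addr0; have hE2' : 8 * M%:R * #|E2|%:R <= delta * n%:R.
    apply: (@le_trans _ _ (8 * M%:R * (2 * c2 * n%:R))); first by rewrite ler_pM2l // mulr_gt0.
    have -> : 8 * M%:R * (2 * c2 * n%:R) = 16 * M%:R * c2 * n%:R by ring.
    by rewrite ler_pM2r.
  have [D DK [h1 h2 h3]] := not_robust_sparse_cut delta0 M0 hmid hE2' nrob.
  have -> // : [exists D in K, [&& b <= #|D|%:R, b <= #|L :\: D|%:R &
     #|E2 :&: cross D (L :\: D)|%:R <= e2 * n%:R]].
  by apply/exists_inP; exists D => //; apply/and3P; split.
rewrite gnp_expD; apply: lerD; last by apply: prob_many_edges; rewrite ?np.
apply: (le_trans (prob_sparse_cut _ _ _ p01 (ltW b0))).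
have hkb : n%:R <= k%:R * b.
  have -> : k%:R * b = k%:R * delta / 2 * n%:R by rewrite /b; ring.
  by rewrite ler_peMl ?ler0n //; lra.
apply: (le_trans (ler_wpM2r (expR_ge0 _) (card_sparse_cuts E1 (e2 * n%:R) U0 b0 hkb))).
rewrite -[leLHS]mulrA ler_pM2l ?exprn_gt0 // -expRD ler_expR.
have h1 : expR (- U) * #|E1|%:R <= expR (- U) * (2 * c * n%:R) by rewrite ler_pM2l ?expR_gt0.
have -> : p * (b * b) = c2 * delta ^+ 2 / 4 * n%:R by rewrite -np /b; field.
lra.
Qed.

Lemma robust_whp (R : realType) (c clo lam eta eps delta : R) :
  0 < clo < c -> 0 < lam -> 0 < eta -> 0 < eps -> 0 < delta ->
  (forall er, 0 < er -> exists N : nat, forall (n : nat) (p : R), (N <= n)%N ->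
     0 <= p <= 1 -> clo <= n%:R * p <= c ->
     gnp_exp p (fun E : graph n => `[< ~ expanding lam eta eps delta E >]%:R) <= er) ->
  exists (l : nat) (e2 : R), 0 < e2 /\ forall er, 0 < er -> exists N : nat,
    forall n : nat, (N <= n)%N ->
    gnp_exp (c / n%:R) (fun E : graph n => `[< ~ robust delta l e2 E >]%:R) <= er.
Proof.
move=> /andP[clo0 cloc] lam0 eta0 eps0 delta0 Hexp.
have c0 : 0 < c by apply: lt_trans cloc.
have q0 : 0 < (lam * (delta / 8))^-1 by rewrite invr_gt0 mulr_gt0 // divr_gt0.
have [M hM] := exists_nat_gt ((lam * (delta / 8))^-1 / eta).
have MR : 0 < M%:R :> R by apply: lt_trans hM; rewrite divr_gt0.
have M0 : (0 < M)%N by rewrite -(ltr_nat R).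
have hM' : (lam * (delta / 8))^-1 <= expR (eta * M%:R).
  apply: le_trans (expR_ge1Dx _); apply: (@le_trans _ _ (eta * M%:R)); last by rewrite lerDr.
  by rewrite [leRHS]mulrC -ler_pdivrMr //; apply: ltW.
(* [c2] is the value of [n * p] for the sprinkled graph: small enough that the first graph keeps
   [n * p] above [clo], and that [2 * c2 * n] sprinkled edges account for few vertices. *)
pose c2 := Num.min (c - clo) (delta / (16 * M%:R)).
have c20 : 0 < c2.
  by rewrite lt_min subr_gt0 cloc divr_gt0 // mulr_gt0.
have c2a : c2 <= c - clo by rewrite ge_min lexx.
have c2b : 16 * M%:R * c2 <= delta.
  have : c2 <= delta / (16 * M%:R) by rewrite ge_min lexx orbT.
  by rewrite ler_pdivlMr ?mulr_gt0 // mulrC.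
(* The gain [c2 * delta ^+ 2 / 8] equals [4 * w]. [U], and then [e2], are chosen so that
   [2 * c * expR (- U)] and [(U + 1) * e2] cost at most [w] each, which leaves [- (2 * w)]. *)
pose w := c2 * delta ^+ 2 / 32.
have w0 : 0 < w by rewrite divr_gt0 // mulr_gt0 // exprn_gt0.
have wc0 : 0 < w / (2 * c) by rewrite divr_gt0 // mulr_gt0.
have [U0 hU0] := exists_expn_le ltr01 wc0.
pose U : R := U0%:R.
have hU : 2 * c * expR (- U) <= w.
  have := hU0 U0 (leqnn _); rewrite mul1r -/U => h.
  have : 2 * c * expR (- U) <= 2 * c * (w / (2 * c)) by rewrite ler_pM2l // mulr_gt0.
  by rewrite [X in _ <= X]mulrC divfK // gt_eqF // mulr_gt0.
have U1 : 0 < U + 1 by rewrite ltr_wpDl.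
pose e2 := w / (U + 1).
have e20 : 0 < e2 by rewrite divr_gt0.
have hUe2 : (U + 1) * e2 = w by rewrite mulrC divfK // gt_eqF.
have [k hk] := exists_nat_gt (2 / delta).
have hk' : 2 <= k%:R * delta by rewrite -ler_pdivrMr // ltW.
exists (8 * M)%N, e2; split => // er er0.
have er4 : 0 < er / 4 by rewrite divr_gt0.
have [N1 hN1] := Hexp _ er4.
have c_half : 0 < c / 2 by rewrite divr_gt0.
have [N2 hN2] := exists_expn_le c_half er4.
have w2 : 0 < 2 * w by rewrite mulr_gt0.
have erk : 0 < er / 4 / 2 ^+ k by rewrite divr_gt0 // exprn_gt0.
have [N3 hN3] := exists_expn_le w2 erk.
have c2_half : 0 < c2 / 2 by rewrite divr_gt0.
have [N4 hN4] := exists_expn_le c2_half er4.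
have [N5 hN5] := exists_nat_gt c.
exists (maxn (maxn N1 N2) (maxn (maxn N3 N4) N5)) => n; rewrite !geq_max.
case/andP=> /andP[n1 n2] /andP[/andP[n3 n4] n5].
have cn : c < n%:R by apply: (lt_le_trans hN5); rewrite ler_nat.
have nR : 0 < n%:R :> R by apply: lt_trans cn.
have n0 : (0 < n)%N by rewrite -(ltr_nat R).
have c2c : c2 < c by lra.
pose p2 := c2 / n%:R; pose p := c / n%:R.
have p1 : p < 1 by rewrite ltr_pdivrMr ?mul1r.
have p2p : p2 < p by rewrite ltr_pM2r ?invr_gt0.
have p20 : 0 < p2 by rewrite divr_gt0.
have q2 : 0 < 1 - p2 by rewrite subr_gt0; apply: lt_trans p1.
have np2 : n%:R * p2 = c2 by rewrite mulrC divfK // gt_eqF.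
have np : n%:R * p = c by rewrite mulrC divfK // gt_eqF.
(* Solves [1 - p = (1 - p1') * (1 - p2)]; it lies between [p - p2] and [p], so expansion applies to
   the first graph. *)
pose p1' := (p - p2) / (1 - p2).
have p1E : p1' * (1 - p2) = p - p2 by rewrite divfK // gt_eqF.
have p1'0 : 0 < p1' by rewrite divr_gt0 // subr_gt0.
have p1'1 : p1' <= 1 by rewrite ler_pdivrMr // mul1r; lra.
have p1'p : p1' <= p.
  rewrite ler_pdivrMr //; have : p * p2 <= 1 * p2 by rewrite ler_pM2r // ltW.
  lra.
have p1'lo : p - p2 <= p1' by rewrite ler_pdivlMr // ler_piMr //; lra.
have np1 : clo <= n%:R * p1' <= c.
  apply/andP; split; last by rewrite -np ler_pM2l.
  apply: (@le_trans _ _ (n%:R * (p - p2))); last by rewrite ler_pM2l.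
  by rewrite mulrBr np np2; lra.
have p1'01 : 0 <= p1' <= 1 by rewrite (ltW p1'0).
have p201 : 0 <= p2 <= 1 by rewrite (ltW p20) /=; lra.
rewrite -/p (@gnp_exp_union _ _ p p1' p2); last by rewrite -[LHS]addr0; lra.
apply: (@le_trans _ _ (gnp_exp p1' (fun E1 : graph n =>
   (`[< ~ expanding lam eta eps delta E1 >]%:R + (2 * c * n%:R < #|E1|%:R)%R%:R) + er / 2))).
  apply: gnp_exp_le => // E1.
  have le1 : gnp_exp p2 (fun E2 => `[< ~ robust delta (8 * M) e2 (E1 :|: E2) >]%:R) <= 1.
    by rewrite -[leRHS](@gnp_exp1 R n p2); apply: gnp_exp_le => // E2; case: asboolP.
  have er2 : 0 <= er / 2 by lra.
  case: asboolP => [_|/contrapT expE].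
    by apply: (le_trans le1); rewrite -addrA lerDl addr_ge0.
  case: ltP => hE1; first by apply: (le_trans le1); rewrite add0r lerDl.
  rewrite !add0r.
  apply: (le_trans (@prob_not_robust_given _ n M k E1 lam eta eps delta p2 c c2 e2 U
     p201 np2 n0 M0 c2b expE lam0 (ltW eta0) (ltW eps0) delta0 hM' hE1 _ hk')) => //.
  have -> : er / 2 = er / 4 + er / 4 by lra.
  apply: lerD; last exact: hN4.
  apply: (@le_trans _ _ (2 ^+ k * expR (- (2 * w * n%:R)))).
    rewrite ler_pM2l ?exprn_gt0 // ler_expR -[leRHS]mulNr ler_pM2r // hUe2.
    rewrite /w in hU *; lra.
  by rewrite mulrC -ler_pdivlMr ?exprn_gt0 //; apply: hN3.
rewrite !gnp_expD gnp_exp_const.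
have h1 := hN1 n p1' n1 p1'01 np1.
have h2 : gnp_exp p1' (fun E1 : graph n => (2 * c * n%:R < #|E1|%:R)%R%:R) <= er / 4.
  by apply: le_trans (hN2 n n2); apply: prob_many_edges => //; case/andP: np1.
lra.
Qed.

(** * Growth of balls and Lipschitz functions *)

Lemma ball_mono (T : finType) (e : rel T) (A A' : {set T}) (k : nat) :
  A \subset A' -> ball e A k \subset ball e A' k.
Proof.
move=> AA'; elim: k => [|k IH] //; apply/subsetP => w /ballS[wk|[v vk vw]]; apply/ballS.
  by left; apply: (subsetP IH).
by right; exists v => //; apply: (subsetP IH).
Qed.

Lemma ball_center (T : finType) (e : rel T) (A : {set T}) (k : nat) (w : T) :
  w \in ball e A k -> exists2 a, a \in A & w \in ball e [set a] k.
Proof.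
elim: k w => [|k IH] w; first by move=> wA; exists w; rewrite // /ball /= inE.
case/ballS => [wk|[v vk vw]].
  by have [a aA wa] := IH w wk; exists a => //; apply/ballS; left.
by have [a aA va] := IH v vk; exists a => //; apply/ballS; right; exists v.
Qed.

Lemma ball_induced_connect (n : nat) (E : graph n) (A : {set 'I_n}) (a w : 'I_n) (i j : nat) :
  a \in A -> (j <= i)%N -> w \in ball (adj E) [set a] j ->
  connect (induced E (ball (adj E) A i)) a w.
Proof.
move=> aA; elim: j w => [|j IH] w ji; first by rewrite /ball /= inE => /eqP ->.
case/ballS => [wj|[v vj vw]]; first by apply: IH => //; apply: ltnW.
apply: connect_trans (IH v (ltnW ji) vj) _; apply: connect1; rewrite /induced vw andbT.
have sub (u : 'I_n) k : (k <= i)%N -> u \in ball (adj E) [set a] k -> u \in ball (adj E) A i.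
  move=> ki uk; apply: (subsetP (sub_ball _ _ ki)).
  by apply: (subsetP (ball_mono _ _ _)) uk; rewrite sub1set.
rewrite (sub v j (ltnW ji)) //=; apply: (sub w j.+1 ji).
by apply/ballS; right; exists v.
Qed.

(** A ball that fails to grow is closed under [e], hence contains everything reachable from [a], and
    [b] in particular. Until [b] is reached, each step adds a vertex. *)
Lemma card_ball1 (T : finType) (e : rel T) (a b : T) (j : nat) :
  connect e a b -> b \notin ball e [set a] j -> (j < #|ball e [set a] j|)%N.
Proof.
move=> ab; elim: j => [|j IH] bj; first by rewrite /ball /= cards1.
have bj' : b \notin ball e [set a] j.
  by apply: contra bj => ?; apply/ballS; left.
apply: (leq_ltn_trans (IH bj')); apply: proper_card; rewrite properE sub_ballS /=.
apply: contra bj' => /subsetP cl; case/connectP: ab => p pp ->.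
have aj : a \in ball e [set a] j.
  by apply: (subsetP (sub_ball _ _ (leq0n j))); rewrite /ball /= inE.
elim: p {1 3 4}a aj pp => [|x p IHp] y yj //= /andP[yx pp].
by apply: IHp => //; apply: cl; apply/ballS; right; exists y.
Qed.

(** Each vertex of the ball lies in the ball around a single centre [a]; that one is connected
    inside the large ball, and has more than [i] vertices because it has not reached [b]. *)
Lemma ball_forest (n : nat) (E : graph n) (A : {set 'I_n}) (b : 'I_n) (i : nat) :
  (forall a, a \in A -> connect (adj E) a b) -> b \notin ball (adj E) A i ->
  exists2 par, is_forest E (ball (adj E) A i) par &
    (#|forest_roots (ball (adj E) A i) par| * i.+1 <= #|ball (adj E) A i|)%N.
Proof.
move=> Ab bA; apply: exists_forest => v /ball_center[a aA va].
have ba : b \notin ball (adj E) [set a] i.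
  by apply: contra bA; apply: (subsetP (ball_mono _ _ _)); rewrite sub1set.
apply: (leq_trans (card_ball1 (Ab a aA) ba)); apply: subset_leq_card.
apply/subsetP => w wa; rewrite inE.
apply: connect_trans (ball_induced_connect aA (leqnn i) wa).
rewrite (sym_connect_sym (@inducedC n E _)).
exact: (ball_induced_connect aA (leqnn i) va).
Qed.

(** A vertex of the ball of radius [i] has all its neighbours in the next ball, so the inner
    boundary of the next ball consists of newly added vertices. *)
Lemma ball_growth (R : realType) (n : nat) (E : graph n) (lam eta eps delta a : R)
    (A : {set 'I_n}) (b : 'I_n) (ell i : nat) :
  expanding lam eta eps delta E -> 0 < lam -> 0 <= eta -> 0 < a -> a <= #|A|%:R ->
  n%:R / (lam * a) <= expR (eta * ell.+1%:R) -> (ell <= i)%N ->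
  (forall v, v \in A -> connect (adj E) v b) -> b \notin ball (adj E) A i.+1 ->
  #|ball (adj E) A i.+1|%:R <= delta * n%:R ->
  #|ball (adj E) A i|%:R <= (1 - eps) * #|ball (adj E) A i.+1|%:R.
Proof.
move=> expE lam0 eta0 a0 aA hell elli Ab bA small.
set S := ball (adj E) A i.+1 in bA small *.
have [par fE hr] := ball_forest Ab bA; rewrite -/S in fE hr.
have aS : a <= #|S|%:R.
  by apply: (le_trans aA); rewrite ler_nat subset_leq_card // (sub_ball _ _ (leq0n i.+1)).
have S0 : 0 < #|S|%:R :> R by apply: lt_le_trans aS.
have S0' : (0 < #|S|)%N by rewrite -(ltr_nat R).
have bdry : eps * #|S|%:R < #|inner_boundary E S|%:R.
  rewrite ltNge; apply/negP => hb; apply: (expE S) => //; exists par; split => //.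
  (* Since [a <= #|S|], one root costs at most [expR (eta * ell.+1)], and the trees have on average
     more than [ell] vertices. *)
  apply: (@le_trans _ _ (expR (eta * ell.+1%:R) ^+ #|forest_roots S par|)).
    apply: lerXn2r; rewrite ?nnegrE ?expR_ge0 //.
      by rewrite divr_ge0 // mulr_ge0 // ltW.
    apply: le_trans hell; rewrite ler_wpM2l // lef_pV2 ?posrE ?mulr_gt0 //.
    by rewrite ler_pM2l.
  rewrite -expRM_natr ler_expR -mulrA ler_wpM2l // -natrM ler_nat mulnC.
  by apply: (leq_trans _ hr); rewrite leq_mul2l orbC !ltnS (leq_trans elli).
have sub : inner_boundary E S \subset S :\: ball (adj E) A i.
  apply/subsetP => v; rewrite !inE => /andP[vS /existsP[w /andP[wS vw]]].
  rewrite vS andbT; apply: contra wS => vi; apply/ballS; right; by exists v.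
have := subset_leq_card sub; rewrite cardsDS ?sub_ballS // -(ler_nat R).
rewrite natrB; last by rewrite subset_leq_card // sub_ballS.
move=> h; lra.
Qed.

(** Radius [ell] makes the trees large enough for expansion. Were the final ball small, each of the
    last [k] balls would be at most a fraction [1 - eps] of its successor, giving
    [a <= (1 - eps) ^+ k * (delta * n)]. *)
Lemma ball_large (R : realType) (n : nat) (E : graph n) (lam eta eps delta a : R)
    (A : {set 'I_n}) (b : 'I_n) (ell k : nat) :
  expanding lam eta eps delta E -> 0 < lam -> 0 <= eta -> eps <= 1 -> 0 < a -> a <= #|A|%:R ->
  n%:R / (lam * a) <= expR (eta * ell.+1%:R) ->
  (forall v, v \in A -> connect (adj E) v b) -> b \notin ball (adj E) A (ell + k) ->
  (1 - eps) ^+ k * (delta * n%:R) < a ->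
  delta * n%:R < #|ball (adj E) A (ell + k)|%:R.
Proof.
move=> expE lam0 eta0 eps1 a0 aA hell Ab bA hk; rewrite ltNge; apply/negP => small.
have : a <= (1 - eps) ^+ k * #|ball (adj E) A (ell + k)|%:R.
  have : (k <= k)%N by [].
  elim: {-2}k => [_|j IH jk].
    rewrite mul1r addn0; apply: (le_trans aA).
    by rewrite ler_nat subset_leq_card // (sub_ball _ _ (leq0n ell)).
  apply: (le_trans (IH (ltnW jk))); rewrite exprSr -mulrA.
  rewrite ler_wpM2l ?exprn_ge0 ?subr_ge0 // addnS.
  have jk' : ((ell + j).+1 <= ell + k)%N by rewrite -addnS leq_add2l.
  apply: (ball_growth expE lam0 eta0 a0 aA hell (leq_addr _ _) Ab).
    by apply: contra bA; apply: (subsetP (sub_ball _ _ jk')).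
  by apply: le_trans small; rewrite ler_nat subset_leq_card // sub_ball.
move=> h; have := lt_le_trans hk h; apply/negP; rewrite -leNgt.
by rewrite ler_wpM2l ?exprn_ge0 ?subr_ge0.
Qed.

(** An edge leaving the ball of radius [i + j] ends in the next ball, so the [J] cuts are disjoint
    and one of them has at most [#|E| / J] edges. *)
Lemma ball_sparse_cut (n : nat) (E : graph n) (A : {set 'I_n}) (i J : nat) :
  (0 < J)%N -> exists2 j, (j < J)%N &
    (#|E :&: cross (ball (adj E) A (i + j)) (~: ball (adj E) A (i + j))| * J <= #|E|)%N.
Proof.
move=> J0; pose S j := ball (adj E) A (i + j); pose X j := E :&: cross (S j) (~: S j).
have disj e j j' : (j < j')%N -> e \in X j -> e \in X j' -> False.
  move=> jj'; rewrite !in_setI => /andP[eE /crossP[v [w [vS wS ee]]]] /andP[_].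
  rewrite {}ee in eE *; rewrite in_cross_compl.
  have vw : adj E v w.
    by rewrite /adj eE andbT; apply: contraTneq vS => ->; move: wS; rewrite inE.
  have sub : S j.+1 \subset S j' by apply: sub_ball; rewrite leq_add2l.
  rewrite (subsetP sub v) ?(subsetP sub w) //; rewrite /S addnS; apply/ballS; last by left.
  by right; exists v.
have sumX : (\sum_(j < J) #|X j| <= #|E|)%N.
  under eq_bigr do rewrite -sum1_card big_mkcond /=.
  rewrite exchange_big -sum1_card [X in (_ <= X)%N]big_mkcond; apply: leq_sum => e _ /=.
  have [[j ej]|no] := pselect (exists j : 'I_J, e \in X j).
    rewrite (bigD1 j) //= ej (_ : e \in E); last by move: ej; rewrite inE => /andP[].
    rewrite big1 // => j' neq; case: ifP => // ej'.
    have : (j != j' :> nat) by rewrite eq_sym.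
    by rewrite neq_ltn => /orP[/disj|/disj] /(_ e); tauto.
  rewrite big1 // => j _; case: ifP => // ej; by case: no; exists j.
apply: contrapT => nex; suff : (#|E| < #|E|)%N by rewrite ltnn.
have big j : (j < J)%N -> (#|E| < #|X j| * J)%N.
  by move=> jJ; rewrite ltnNge; apply/negP => h; apply: nex; exists j.
have : (J * #|E| < J * #|E|)%N; last by rewrite ltnn.
apply: (@leq_trans ((\sum_(j < J) #|X j|) * J)%N); last by rewrite mulnC leq_mul2l sumX orbT.
rewrite big_distrl /= -[J in (J * _)%N]card_ord -sum_nat_const.
case: J J0 {sumX nex} big => // J _ big; rewrite !big_ord_recl -addSn leq_add ?big //.
by apply: leq_sum => j _; apply/ltnW/big.
Qed.

(** If the balls do not meet, every ball around [A] of radius [T + j] with [j < J] separates two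
    linear-size sets, yet one of these cuts has at most [#|E| / J <= e2 * n] edges. *)
Lemma balls_meet (R : realType) (n : nat) (E : graph n) (lam eta eps delta a c e2 : R)
    (v0 : 'I_n) (A B : {set 'I_n}) (l ell k J : nat) :
  expanding lam eta eps delta E -> robust delta l e2 E -> #|E|%:R <= 2 * c * n%:R ->
  0 < lam -> 0 <= eta -> eps <= 1 -> 0 < a -> a <= #|A|%:R -> a <= #|B|%:R ->
  A \subset component E v0 -> B \subset component E v0 ->
  n%:R / (lam * a) <= expR (eta * ell.+1%:R) -> (1 - eps) ^+ k * (delta * n%:R) < a ->
  (l <= ell.+1)%N -> 2 * c <= e2 * J%:R -> (0 < J)%N ->
  exists2 v, v \in ball (adj E) A (ell + k + J) & v \in ball (adj E) B (ell + k).
Proof.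
move=> expE rob hE lam0 eta0 eps1 a0 aA aB AH BH hell hk hl hJ J0.
set T := (ell + k)%N; apply: contrapT => nex.
have disj v : v \in ball (adj E) A (T + J) -> v \in ball (adj E) B T -> False.
  by move=> vA vB; apply: nex; exists v.
have symc : connect_sym (adj E) := sym_connect_sym (@adjC n E).
have conn x y : x \in component E v0 -> y \in component E v0 -> connect (adj E) x y.
  by rewrite !inE symc => xv vy; apply: connect_trans vy.
have ex (C : {set 'I_n}) : a <= #|C|%:R -> exists u : 'I_n, u \in C.
  by move=> aC; apply/card_gt0P; rewrite -(ltr_nat R); apply: lt_le_trans aC.
have subA : A \subset ball (adj E) A (T + J) by apply: (sub_ball _ _ (leq0n _)).
have subB : B \subset ball (adj E) B T by apply: (sub_ball _ _ (leq0n _)).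
have subT : ball (adj E) A T \subset ball (adj E) A (T + J) by apply: sub_ball; apply: leq_addr.
have [x xA] := ex _ aA; have [y yB] := ex _ aB.
have yA : y \notin ball (adj E) A T.
  by apply/negP => yA; apply: (disj y); [apply: (subsetP subT)|apply: (subsetP subB)].
have xB : x \notin ball (adj E) B T.
  by apply/negP => xB; apply: (disj x) => //; apply: (subsetP subA).
have Ay v : v \in A -> connect (adj E) v y.
  by move=> vA; apply: conn; [apply: (subsetP AH)|apply: (subsetP BH)].
have Bx v : v \in B -> connect (adj E) v x.
  by move=> vB; apply: conn; [apply: (subsetP BH)|apply: (subsetP AH)].
have largeA := ball_large expE lam0 eta0 eps1 a0 aA hell Ay yA hk.
have largeB := ball_large expE lam0 eta0 eps1 a0 aB hell Bx xB hk.
have [parA fA rA] := ball_forest Ay yA.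
have [parB fB rB] := ball_forest Bx xB.
have [j jJ hj] := ball_sparse_cut E A T J0.
have lT (r s : nat) : (r * T.+1 <= s)%N -> (l * r <= s)%N.
  move=> h; apply: leq_trans h; rewrite mulnC leq_mul2l; apply/orP; right.
  by apply: (leq_trans hl); rewrite ltnS leq_addr.
have := rob (ball (adj E) A (T + j)) _ _ parA parB _ _ fA fB (ltW largeA) (ltW largeB) (lT _ _ rA) (lT _ _ rB).
have -> : ball (adj E) A T \subset ball (adj E) A (T + j) by apply: sub_ball; apply: leq_addr.
have -> : ball (adj E) B T \subset ~: ball (adj E) A (T + j).
  apply/subsetP => v vB; rewrite inE; apply/negP => vA; apply: (disj v) => //.
  by apply: (subsetP (sub_ball _ _ _)) vA; rewrite leq_add2l ltnW.
move=> /(_ isT isT); apply/negP; rewrite -leNgt.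
have JR : 0 < J%:R :> R by rewrite ltr0n.
rewrite -(ler_pM2r JR) -natrM; apply: (@le_trans _ _ #|E|%:R); first by rewrite ler_nat.
by apply: (le_trans hE); rewrite [leRHS]mulrAC; apply: ler_wpM2r.
Qed.

(** * From meeting balls to the tail of a Lipschitz function *)

Lemma lipschitz_ball_lt (R : realType) (n : nat) (E : graph n) (v0 : 'I_n) (f : 'I_n -> R)
    (A : {set 'I_n}) (t : R) (k : nat) :
  lipschitz_on E (component E v0) f -> A \subset component E v0 ->
  (forall v, v \in A -> t < f v) ->
  forall v, v \in ball (adj E) A k -> v \in component E v0 /\ t - k%:R < f v.
Proof.
move=> lip AH hA; elim: k => [|k IH] v.
  by move=> vA; rewrite subr0; split; [apply: (subsetP AH)|apply: hA].
rewrite -natr1; case/ballS => [vk|[u uk uv]].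
  by have [? ?] := IH v vk; split => //; lra.
have [uH fu] := IH u uk.
have vH : v \in component E v0.
  by move: uH; rewrite !inE => uH; apply: connect_trans uH (connect1 uv).
by split=> //; have := lip u v uH vH uv; rewrite ler_norml => /andP[h1 h2]; lra.
Qed.

Lemma lipschitz_ball_le (R : realType) (n : nat) (E : graph n) (v0 : 'I_n) (f : 'I_n -> R)
    (A : {set 'I_n}) (t : R) (k : nat) :
  lipschitz_on E (component E v0) f -> A \subset component E v0 ->
  (forall v, v \in A -> f v <= t) ->
  forall v, v \in ball (adj E) A k -> v \in component E v0 /\ f v <= t + k%:R.
Proof.
move=> lip AH hA; elim: k => [|k IH] v.
  by move=> vA; rewrite addr0; split; [apply: (subsetP AH)|apply: hA].
rewrite -natr1; case/ballS => [vk|[u uk uv]].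
  by have [? ?] := IH v vk; split => //; lra.
have [uH fu] := IH u uk.
have vH : v \in component E v0.
  by move: uH; rewrite !inE => uH; apply: connect_trans uH (connect1 uv).
by split=> //; have := lip u v uH vH uv; rewrite ler_norml => /andP[h1 h2]; lra.
Qed.

(** One-sided, so that it can be applied to [f] and to [- f]. At a common vertex of the two balls,
    [f] exceeds [m + x - (ell + k + J)] and is at most [m + ell + k]. Hence
    [x <= 2 * (ell + k) + J], which is bounded by an affine function of [ln (n / #|A|)]. *)
Lemma lipschitz_tail (R : realType) (n : nat) (E : graph n) (lam eta eps delta c e2 : R)
    (v0 : 'I_n) (l J : nat) (f : 'I_n -> R) (m x : R) :
  expanding lam eta eps delta E -> robust delta l e2 E -> #|E|%:R <= 2 * c * n%:R ->
  0 < lam <= 1 -> 0 < eta -> 0 < eps < 1 -> delta < 1 -> 2 * c <= e2 * J%:R -> (0 < J)%N ->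
  lipschitz_on E (component E v0) f -> 0 <= x ->
  (#|component E v0| <= 2 * #|[set v in component E v0 | (f v <= m)%R]|)%N ->
  #|[set v in component E v0 | x < f v - m]|%:R <=
  n%:R * expR ((2 * (l%:R - ln lam / eta + 2) + J%:R - x) / (2 * (eta^-1 + eps^-1))).
Proof.
move=> expE rob hE /andP[lam0 lam1] eta0 /andP[eps0 eps1] delta1 hJ J0 lip x0 med.
set H := component E v0; set A := [set v in H | x < f v - m]; set B := [set v in H | f v <= m].
set K0 := 2 * _ + _; set K1 := 2 * (_ + _).
have K1pos : 0 < K1 by rewrite mulr_gt0 // addr_gt0 ?invr_gt0.
have AB : (#|A| <= #|B|)%N.
  have : (#|A| + #|B| <= #|H|)%N.
    have dAB : A :&: B = set0.
      apply/setP => v; rewrite !inE; apply/negP => /andP[/andP[_ h1] /andP[_ h2]]; lra.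
    rewrite -cardsUI dAB cards0 addn0.
    by apply: subset_leq_card; apply/subsetP => v; rewrite !inE => /orP[]/andP[].
  move: med; rewrite -/H -/B; lia.
(* An empty [A] is set apart because [n / #|A|] is used from here on. *)
have [->|A0] := posnP #|A|; first by rewrite mulr_ge0 ?expR_ge0.
set a : R := #|A|%:R.
have a0 : 0 < a by rewrite ltr0n.
have an : a <= n%:R by rewrite ler_nat -[X in (_ <= X)%N]card_ord max_card.
have n0 : 0 < n%:R :> R by apply: lt_le_trans an.
pose r := n%:R / a.
have r1 : 1 <= r by rewrite ler_pdivlMr // mul1r.
have r0 : 0 < r by apply: lt_le_trans r1.
have lr0 : 0 <= ln r by apply: ln_ge0.
have llam : ln lam <= 0 by apply: ln_le0.
(* [ell] makes the trees large enough for expansion from [a] vertices and, through the summand [l],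
   for robustness; [k] is such that [(1 - eps) ^+ k <= a / n]. *)
pose ell := (l + Num.truncn ((ln r - ln lam) / eta))%N.
pose k := (Num.truncn (ln r / eps)).+1.
have q0 : 0 <= (ln r - ln lam) / eta by rewrite divr_ge0 ?(ltW eta0) //; lra.
have q1 : 0 <= ln r / eps by rewrite divr_ge0 ?(ltW eps0).
have /andP[tl1 tl2] := truncn_itv q0.
have /andP[tk1 tk2] := truncn_itv q1.
have hell : n%:R / (lam * a) <= expR (eta * ell.+1%:R).
  have -> : n%:R / (lam * a) = expR (ln r - ln lam).
    rewrite expRD expRN !lnK ?posrE //; rewrite /r invfM; ring.
  rewrite ler_expR mulrC -ler_pdivrMr //; apply: (le_trans (ltW tl2)).
  by rewrite ler_nat ltnS leq_addl.
have hk : (1 - eps) ^+ k * (delta * n%:R) < a.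
  have h1 : (1 - eps) ^+ k <= r^-1.
    apply: (le_trans (one_sub_expn_le k (ltW eps1))); rewrite -[in leRHS](lnK r0) -expRN ler_expR lerN2.
    by rewrite mulrC -ler_pdivrMr // ltW.
  have h2 : 0 <= (1 - eps) ^+ k by rewrite exprn_ge0 // subr_ge0 ltW.
  have h3 : 0 < (1 - eps) ^+ k by rewrite exprn_gt0 // subr_gt0.
  apply: (@lt_le_trans _ _ ((1 - eps) ^+ k * n%:R)).
    by rewrite ltr_pM2l // gtr_pMl.
  apply: (@le_trans _ _ (r^-1 * n%:R)); first by rewrite ler_wpM2r // ltW.
  by rewrite /r invf_div divfK // gt_eqF.
have AH : A \subset H by apply/subsetP => v; rewrite inE => /andP[].
have BH : B \subset H by apply/subsetP => v; rewrite inE => /andP[].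
have aB : a <= #|B|%:R by rewrite ler_nat.
have hl : (l <= ell.+1)%N by rewrite ltnW // ltnS leq_addr.
have hkR : k%:R <= ln r / eps + 1 by rewrite /k -natr1 lerD2r.
have hellR : ell%:R <= l%:R + (ln r - ln lam) / eta by rewrite /ell natrD lerD2l.
clearbody ell k.
have [v vA vB] := balls_meet expE rob hE lam0 (ltW eta0) (ltW eps1) a0 (lexx _) aB AH BH hell hk hl hJ J0.
have fA u : u \in A -> m + x < f u by rewrite inE ltrBrDl => /andP[].
have fB u : u \in B -> f u <= m by rewrite inE => /andP[_ h].
have [_ h1] := lipschitz_ball_lt lip AH fA vA.
have [_ h2] := lipschitz_ball_le lip BH fB vB.
rewrite !natrD in h1 h2.
have x1 : x <= 2 * (ell%:R + k%:R) + J%:R by move: h1 h2; clear => h1 h2; lra.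
have xlt : x <= K0 + K1 * ln r.
  have -> : K0 + K1 * ln r = 2 * ((l%:R + (ln r - ln lam) / eta) + (ln r / eps + 1)) + J%:R + 2.
    by rewrite /K0 /K1; ring.
  by move: x1 hkR hellR; clear => x1 hkR hellR; lra.
(* After inversion and logarithms the goal is [xlt] solved for [ln r]. *)
rewrite mulrC -ler_pdivrMr // -[leLHS]invrK invf_div -/r -[r](lnK r0) -expRN ler_expR.
by rewrite ler_pdivlMr //; move: xlt; clear => xlt; lra.
Qed.

Lemma deviation_bound (R : realType) (n : nat) (E : graph n) (lam eta eps delta c e2 : R)
    (v0 : 'I_n) (l J : nat) (f : 'I_n -> R) (m x : R) :
  expanding lam eta eps delta E -> robust delta l e2 E -> #|E|%:R <= 2 * c * n%:R ->
  0 < lam <= 1 -> 0 < eta -> 0 < eps < 1 -> delta < 1 -> 2 * c <= e2 * J%:R -> (0 < J)%N ->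
  lipschitz_on E (component E v0) f -> 0 <= x -> is_median (component E v0) f m ->
  #|[set v in component E v0 | x < `|f v - m|]|%:R <=
  2 * (n%:R * expR ((2 * (l%:R - ln lam / eta + 2) + J%:R - x) / (2 * (eta^-1 + eps^-1)))).
Proof.
move=> expE rob hE hlam eta0 heps delta1 hJ J0 lip x0 [mup mlo].
have up := lipschitz_tail expE rob hE hlam eta0 heps delta1 hJ J0 lip x0 mlo.
have lipN : lipschitz_on E (component E v0) (fun v => - f v).
  by move=> v w vH wH vw; rewrite opprK addrC distrC; apply: lip.
have mup' : (#|component E v0| <= 2 * #|[set v in component E v0 | (- f v <= - m)%R]|)%N.
  by apply: (leq_trans mup); rewrite leq_mul2l subset_leq_card //; apply/subsetP => v; rewrite !inE lerN2.
have lo := lipschitz_tail expE rob hE hlam eta0 heps delta1 hJ J0 lipN x0 mup'.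
set H := component E v0 in up lo *; set Y := _ * expR _ in up lo *.
apply: (@le_trans _ _ (#|[set v in H | x < f v - m]|%:R + #|[set v in H | x < - f v - - m]|%:R)).
  rewrite -natrD ler_nat.
  apply: (leq_trans (_ : _ <= #|[set v in H | (x < f v - m)%R] :|: [set v in H | (x < - f v - - m)%R]|)%N).
    apply: subset_leq_card; apply/subsetP => v; rewrite !inE => /andP[->] /=.
    by rewrite lter_normr opprB opprK [- f v + m]addrC.
  by rewrite cardsU leq_subr.
lra.
Qed.

(** * Choice of the constants and conclusion *)

(** Completing the square in [Num.sqrt x - K / 2] weakens decay in [x] to decay in [Num.sqrt x]. *)
Lemma expR_sqrt_le (R : realType) (K x : R) :
  0 < K -> 0 <= x -> expR (- (x / K)) <= expR (K / 4) * expR 1 `^ (- Num.sqrt x).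
Proof.
move=> K0 x0; rewrite -expRM mul1r -expRD ler_expR.
have -> : x / K = Num.sqrt x ^+ 2 / K by rewrite sqr_sqrtr.
have : 0 <= (Num.sqrt x - K / 2) ^+ 2 / K by rewrite divr_ge0 ?sqr_ge0 // ltW.
have -> : (Num.sqrt x - K / 2) ^+ 2 / K = Num.sqrt x ^+ 2 / K - Num.sqrt x + K / 4.
  by field; rewrite gt_eqF.
lra.
Qed.

(** The second condition amounts to [1 + ln c < clo], and [ln c < c - 1] because [c] differs from 1;
    the witness is the midpoint of [1 + ln c] and [c]. Sprinkling spends the room between [clo] and
    [c]. *)
Lemma exists_supercritical_gap (R : realType) (c : R) :
  1 < c -> exists2 clo, 0 < clo < c & c * expR (1 - clo) < 1.
Proof.
move=> c1; have c0 : 0 < c by apply: lt_trans c1.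
have lc0 : 0 < ln c by apply: ln_gt0.
have lc : ln c < c - 1.
  rewrite -ltr_expR lnK ?posrE //; have : c - 1 != 0 by rewrite gt_eqF // subr_gt0.
  by move=> /expR_gt1Dx; rewrite addrC subrK.
exists ((1 + ln c + c) / 2); first by apply/andP; split; lra.
have -> : c * expR (1 - (1 + ln c + c) / 2) = expR (ln c + (1 - (1 + ln c + c) / 2)).
  by rewrite [RHS]expRD lnK.
by rewrite -[ltRHS]expR0 ltr_expR; lra.
Qed.

From mathcomp Require Import classical_sets.

Theorem theorem3p3 (R : realType) (c : R) (hc : 1 < c) :
  exists Cb CB : R, 0 < Cb /\ 1 < CB /\
  forall eps : R, 0 < eps -> exists N : nat, forall n : nat, (N <= n)%N ->
    1 - eps <= gnp_prob (c / n%:R)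
      (fun E : graph n =>
         forall H : {set 'I_n}, largest_component E H ->
         forall f : 'I_n -> R, lipschitz_on E H f ->
         forall m : R, is_median H f m ->
         forall x : R, 0 <= x ->
           (#|[set v in H | x < `|f v - m|]|)%:R < Cb * CB `^ (- Num.sqrt x) * n%:R).
Proof.
have c0 : 0 < c by apply: lt_trans hc.
have [clo /andP[clo0 cloc] hclo] := exists_supercritical_gap hc.
have [lam [eta [eps [delta [hlam eta0 heps /andP[delta0 delta1] Hexp]]]]] :=
  expanding_whp clo0 c0 hclo.
have [lam0 _] := andP hlam; have [eps0 _] := andP heps.
have clo_c : 0 < clo < c by rewrite clo0.
have [l [e2 [e20 Hrob]]] := robust_whp clo_c lam0 eta0 eps0 delta0 Hexp.
(* [J] disjoint cuts of more than [e2 * n] edges each would need more than the [2 * c * n] edges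
   available. *)
have [J hJ] := exists_nat_gt (2 * c / e2).
have hJ' : 2 * c <= e2 * J%:R by rewrite [leRHS]mulrC -ler_pdivrMr // ltW.
have J0 : (0 < J)%N.
  by rewrite -(ltr_nat R); apply: lt_trans hJ; rewrite divr_gt0 // mulr_gt0.
pose K0 := 2 * (l%:R - ln lam / eta + 2) + J%:R.
pose K1 := 2 * (eta^-1 + eps^-1).
have K1pos : 0 < K1 by rewrite mulr_gt0 // addr_gt0 ?invr_gt0.
(* The two one-sided tails give a factor 2, and 3 makes the inequality strict; [K1 / 4] is the loss
   in [expR_sqrt_le]. *)
exists (3 * expR (K0 / K1 + K1 / 4)), (expR 1).
split; first by rewrite mulr_gt0 ?expR_gt0.
split; first by rewrite expR_gt1.
move=> er er0.
have er3 : 0 < er / 3 by rewrite divr_gt0.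
have c_half : 0 < c / 2 by rewrite divr_gt0.
have [N1 hN1] := Hexp _ er3.
have [N2 hN2] := Hrob _ er3.
have [N3 hN3] := exists_expn_le c_half er3.
have [N4 hN4] := exists_nat_gt c.
exists (maxn (maxn N1 N2) (maxn N3 N4)) => n; rewrite !geq_max.
case/andP=> /andP[n1 n2] /andP[n3 n4].
have cn : c < n%:R by apply: (lt_le_trans hN4); rewrite ler_nat.
have n0 : 0 < n%:R :> R by apply: lt_trans cn.
set p := c / n%:R; have np : n%:R * p = c by rewrite mulrC divfK // gt_eqF.
have p01 : 0 <= p <= 1 by rewrite divr_ge0 ?(ltW c0) //= ler_pdivrMr // mul1r ltW.
set good := (X in gnp_prob _ X); rewrite gnp_prob_exp.
(* Every graph is good or lies in one of three failure events, each of probability at most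
   [er / 3]. *)
have sum1 : 1 <= gnp_exp p (fun E : graph n => `[< good E >]%:R +
    (`[< ~ expanding lam eta eps delta E >]%:R +
     (`[< ~ robust delta l e2 E >]%:R + (2 * c * n%:R < #|E|%:R)%R%:R))).
  rewrite -[leLHS](@gnp_exp1 R n p); apply: gnp_exp_le => // E.
  case: (asboolP (~ expanding _ _ _ _ _)) => [_|/contrapT expE].
    by rewrite addrCA lerDl !addr_ge0.
  case: (asboolP (~ robust _ _ _ _)) => [_|/contrapT rob].
    by rewrite add0r addrCA lerDl !addr_ge0.
  case: ltP => hE; first by rewrite !add0r lerDr.
  rewrite !addr0; case: asboolP => // nogood; exfalso; apply: nogood.
  move=> H [[v0 ->] _] f lip m med x x0.
  apply: (le_lt_trans (deviation_bound expE rob hE hlam eta0 heps delta1 hJ' J0 lip x0 med)).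
  rewrite -/K0 -/K1 mulrBl expRD.
  have h := expR_sqrt_le K1pos x0.
  set u := expR 1 `^ _ in h *.
  have u0 : 0 < u by rewrite powR_gt0 ?expR_gt0.
  rewrite expRD.
  apply: (@le_lt_trans _ _ (2 * (n%:R * (expR (K0 / K1) * (expR (K1 / 4) * u))))).
    by rewrite !ler_pM2l ?expR_gt0.
  have -> : 3 * (expR (K0 / K1) * expR (K1 / 4)) * u * n%:R =
     3 * (n%:R * (expR (K0 / K1) * (expR (K1 / 4) * u))) by ring.
  by rewrite ltr_pM2r ?ltr_nat // !mulr_gt0 ?expR_gt0.
rewrite !gnp_expD in sum1.
have h1 : gnp_exp p (fun E : graph n => `[< ~ expanding lam eta eps delta E >]%:R) <= er / 3.
  by apply: hN1; rewrite // np lexx ltW.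
have h2 := hN2 n n2.
have h3 : gnp_exp p (fun E : graph n => (2 * c * n%:R < #|E|%:R)%R%:R) <= er / 3.
  by apply: le_trans (hN3 n n3); apply: prob_many_edges; rewrite ?np.
rewrite -/p in h2; move: sum1 h1 h2 h3; clear => sum1 h1 h2 h3; lra.
Qed.
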